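(* Let $\varphi$ be a complete Bernstein function (with zero killing and zero drift) satisfying (C) and (K) of the context. Assume that (A1)-(A2) hold for $\nu$ and that (B1)-(B2) hold for $\kappa$. Let $\mathcal M_\pm^{(\varphi)}$ be either $\mathcal M_\pm^{(\nu)}$ or $\mathcal M_\pm^{(\kappa)}$, and let $X_\varphi(1_{[0,t)}):=\langle\omega,\mathcal M_-^{(\varphi)}1_{[0,t)}\rangle$. Then the generalized process $(0,\infty)\ni t\mapsto X_\varphi(1_{[0,t)})\in(\mathcal S)^{-1}$ is differentiable: for every $t>0$ the limit $$\lim_{h\to0}\frac{X_\varphi(1_{[0,t+h)})-X_\varphi(1_{[0,t)})}{h}$$ exists in $(\mathcal S)^{-1}$. Denoting the limit by $\mathscr N_t^\varphi\in(\mathcal S)^{-1}$, there are $p',q\in\mathbb N$ such that $$S(\mathscr N_t^\varphi)(\xi)=(\mathcal M_+^{(\varphi)}\xi)(t)\qquad\text{for every }\xi\in U_{p',q}=\{\xi\in\mathcal S_{\mathbb C}:2^q\|\xi\|_{p'}^2<1\}.$$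
   Context: Bernstein function and kernels. $\varphi:(0,\infty)\to[0,\infty)$ is a complete Bernstein function of the form $\varphi(x)=\int_0^\infty(1-e^{-sx})\overline\nu(s)\,ds$, where $\overline\nu$ is a completely monotone Lévy density on $(0,\infty)$ ($\int_0^\infty(s\wedge1)\overline\nu(s)ds<\infty$). $\nu(x):=\int_x^\infty\overline\nu(z)dz$ for $x>0$ and $\nu(x):=0$ for $x\le 0$. $\kappa:(0,\infty)\to[0,\infty)$ is the (locally integrable, non-increasing) Sonine associate of $\nu$, i.e. $\int_0^\infty e^{-s\theta}\kappa(s)ds=1/\varphi(\theta)$, $\theta>0$; $\chi(x):=\int_0^x\kappa(z)dz$ for $x>0$, $\chi(x):=0$ for $x\le0$. Conditions. (C): $\lim_{\theta\to0}\varphi(\theta)=0$ and $\lim_{\theta\to\infty}\varphi(\theta)=+\infty$. (K): $\lim_{\theta\to0}\varphi(\theta)/\theta=+\infty$ and $\lim_{\theta\to\infty}\varphi(\theta)/\theta=0$. (A1): $\overline\nu\in L^2(1,\infty)$. (A2): $\nu\in L^2(0,1)\cap L^p(1,\infty)$ for some $p\ge1$. (B1): $\kappa\in L^1(0,\varepsilon)\cap L^2(\varepsilon,\infty)$ for every $\varepsilon>0$. (B2): $\chi\in L^2(0,\varepsilon)$ for every $\varepsilon>0$. Operators. For $f\in L^1(\mathbb R)$ (derivatives in the distributional sense): $(\mathcal D_-^{(\nu)}f)(x)=-\frac{d}{dx}\int_x^\infty f(t)\nu(t-x)dt$, $(\mathcal D_+^{(\nu)}f)(x)=\frac{d}{dx}\int_{-\infty}^xf(t)\nu(x-t)dt$,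 $(\mathcal I_-^{(\kappa)}f)(x)=\int_x^\infty f(t)\kappa(t-x)dt$, $(\mathcal I_+^{(\kappa)}f)(x)=\int_{-\infty}^xf(t)\kappa(x-t)dt$. In particular $\mathcal D_-^{(\nu)}1_{[0,t)}(u)=\nu((t-u)_+)-\nu((-u)_+)$ and $\mathcal I_-^{(\kappa)}1_{[0,t)}(u)=\chi((t-u)_+)-\chi((-u)_+)$, both in $L^2(\mathbb R)$; for $\xi$ Schwartz, $\mathcal D_+^{(\nu)}\xi$ and $\mathcal I_+^{(\kappa)}\xi$ are $C^\infty$ functions. $C_\nu=\big(\int_{\mathbb R}[\nu((1-u)_+)-\nu((-u)_+)]^2du\big)^{-1}$, $C_\kappa=\big(\int_{\mathbb R}[\chi((1-u)_+)-\chi((-u)_+)]^2du\big)^{-1}$, $\mathcal M_\pm^{(\nu)}:=\sqrt{C_\nu}\,\mathcal D_\pm^{(\nu)}$, $\mathcal M_\pm^{(\kappa)}:=\sqrt{C_\kappa}\,\mathcal I_\pm^{(\kappa)}$; they act complex-linearly on $\mathcal S_{\mathbb C}$. White noise space. $\mathcal S=\mathcal S(\mathbb R)$ is the real Schwartz space, $\mathcal S_{\mathbb C}$ its complexification, $\mathcal S'$ its dual with the cylinder $\sigma$-field $\mathcal B$, and $\mu$ is the white noise measure: $\int_{\mathcal S'}e^{i\langle\omega,\xi\rangle}d\mu(\omega)=e^{-\frac12\|\xi\|_{L^2}^2}$, $\xi\in\mathcal S$. For $f\in L^2(\mathbb R)$, $\langle\omega,f\rangle$ is the $\mu$-a.s.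 defined $L^2(\mu)$-extension of the dual pairing. $\langle\cdot,\cdot\rangle$ is extended complex-bilinearly. Distribution space $(\mathcal S)^{-1}$. Let $A=-\frac{d^2}{dx^2}+x^2+1$ be the harmonic oscillator and $\|f^{(n)}\|_p:=\|(A^p)^{\otimes n}f^{(n)}\|_{L^2(\mathbb R^n)}$, $p\in\mathbb Z$. Every $F\in(L^2):=L^2(\mathcal S',\mathcal B,\mu)$ has a Wiener-Itô-Segal chaos decomposition $F=\sum_{n\ge0}\langle:\omega^{\otimes n}:,f^{(n)}\rangle$ with symmetric $f^{(n)}\in L^2_{\mathbb C}(\mathbb R^n)$ and $\|F\|^2_{(L^2)}=\sum n!\|f^{(n)}\|^2_{L^2(\mathbb R^n)}$. For $p,q\in\mathbb N$ let $(L^2_p)^1_q$ be the Hilbert space with squared norm $\sum_n(n!)^2\,2^{nq}\|f^{(n)}\|_p^2$, and let $(L^2_{-p})^{-1}_{-q}$ be its dual with respect to $(L^2)$, whose elements are generalized chaos expansions $\Phi=(\Phi^{(n)})_n$ with squared norm $\sum_n2^{-nq}\|\Phi^{(n)}\|_{-p}^2<\infty$. Then $(\mathcal S)^{-1}:=\operatorname{ind\,lim}_{p,q}(L^2_{-p})^{-1}_{-q}\supset(L^2)$, with the inductive limit topology. $S$-transform. For $\Phi\in(\mathcal S)^{-1}$, and $\xi$ in a neighbourhood $U_{p,q}=\{\xi\in\mathcal S_{\mathbb C}:2^q\|\xi\|_p^2<1\}$ of zero (with $p,q$ depending on $\Phi$), $(S\Phi)(\xi):=e^{-\frac12\langle\xi,\xi\rangle}\int_{\mathcal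 S'}e^{\langle\omega,\xi\rangle}\Phi(\omega)\mu(d\omega)$, the integral being understood as the dual pairing of $\Phi$ with $e^{\langle\cdot,\xi\rangle}$; equivalently $(S\Phi)(\xi)=\sum_n\langle\Phi^{(n)},\xi^{\otimes n}\rangle$. *)

(* Defs.v *)
From HB Require Import structures.
From mathcomp Require Export all_boot all_order all_algebra all_fingroup.
From mathcomp Require Export all_classical all_reals all_analysis.
From mathcomp Require Export complex.

Set Implicit Arguments.
Unset Strict Implicit.
Unset Printing Implicit Defensive.

Export Order.TTheory GRing.Theory Num.Theory.
Export numFieldNormedType.Exports.

#[global] Open Scope classical_set_scope.
#[global] Open Scope ring_scope.
#[global] Open Scope complex_scope.

Section BernsteinKernels.
Context {R : realType}.
Local Notation leb := (@lebesgue_measure R).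

Definition Lp_on (p : R) (D : set R) (f : R -> R) : Prop :=
  measurable_fun D f /\ (\int[leb]_(x in D) (`|f x| `^ p)%:E < +oo)%E.

Definition completely_monotone (f : R -> R) : Prop :=
  forall (n : nat) (x : R), 0 < x ->
    derivable (derive1n n f) x 1 /\ 0 <= (-1) ^+ n * derive1n n f x.

(* Complete Bernstein function with zero killing rate and zero drift, given
   together with its (unique) Levy density nubar. *)
Definition complete_bernstein (phi nubar : R -> R) : Prop :=
  [/\ completely_monotone nubar,
      (\int[leb]_(s in `]0%R, +oo[) (Num.min s 1 * nubar s)%:E < +oo)%E
    & forall x : R, 0 < x ->
        phi x = \int[leb]_(s in `]0, +oo[) ((1 - expR (- (s * x))) * nubar s)].

Definition cond_C (phi : R -> R) : Prop :=
  phi th @[th --> 0^'+] --> (0 : R) /\ phi th @[th --> +oo] --> +oo.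

Definition cond_K (phi : R -> R) : Prop :=
  (phi th / th) @[th --> 0^'+] --> +oo /\
  (phi th / th) @[th --> +oo] --> (0 : R).

Definition levy_tail (nubar : R -> R) (x : R) : R :=
  if 0 < x then \int[leb]_(z in `]x, +oo[) nubar z else 0.

Definition sonine_associate (phi kappa : R -> R) : Prop :=
  [/\ forall x : R, 0 < x -> 0 <= kappa x,
      forall x y : R, 0 < x -> x <= y -> kappa y <= kappa x,
      forall e : R, 0 < e -> leb.-integrable `]0, e[ (EFin \o kappa)
    & forall th : R, 0 < th ->
        (\int[leb]_(s in `]0%R, +oo[) (expR (- (s * th)) * kappa s)%:E
         = ((phi th)^-1)%:E)%E].

Definition primitive (kappa : R -> R) (x : R) : R :=
  if 0 < x then \int[leb]_(z in `]0, x[) kappa z else 0.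

Definition cond_A1 (nubar : R -> R) : Prop := Lp_on 2 `]1, +oo[ nubar.

Definition cond_A2 (nu : R -> R) : Prop :=
  Lp_on 2 `]0, 1[ nu /\ exists2 p : R, 1 <= p & Lp_on p `]1, +oo[ nu.

Definition cond_B1 (kappa : R -> R) : Prop :=
  forall e : R, 0 < e -> Lp_on 1 `]0, e[ kappa /\ Lp_on 2 `]e, +oo[ kappa.

Definition cond_B2 (chi : R -> R) : Prop :=
  forall e : R, 0 < e -> Lp_on 2 `]0, e[ chi.

End BernsteinKernels.

Section Schwartz.
Context {R : realType}.
Local Notation leb := (@lebesgue_measure R).

Definition schwartz (f : R -> R) : Prop :=
  (forall (n : nat) x, derivable (derive1n n f) x 1) /\
  (forall n k : nat, exists M : R, forall x, `|x ^+ k * derive1n n f x| <= M).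

Record schwartz_fun := SchwartzFun {
  schwartz_val :> R -> R;
  schwartz_valP : schwartz schwartz_val }.

(* S' : continuity of a linear functional is its boundedness by finitely many
   of the seminorms sup |x^a f^(b)(x)|. *)
Record tempered := Tempered {
  dual_pair :> schwartz_fun -> R;
  dual_pair_linear : forall (a : R) (f g h : schwartz_fun),
    (forall x, h x = a * f x + g x) ->
    dual_pair h = a * dual_pair f + dual_pair g;
  dual_pair_continuous : exists (C : R) (N : nat),
    forall (f : schwartz_fun) (M : R),
      (forall a b : nat, (a <= N)%N -> (b <= N)%N ->
         forall x, `|x ^+ a * derive1n b f x| <= M) ->
      `|dual_pair f| <= C * M }.

Definition tempered0 : tempered.
Proof.
refine (@Tempered (fun=> 0) _ _).
- by move=> a f g h _; rewrite mulr0 addr0.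
- by exists 0, 0%N => f M _; rewrite normr0 mul0r.
Defined.

HB.instance Definition _ := gen_eqMixin tempered.
HB.instance Definition _ := gen_choiceMixin tempered.
HB.instance Definition _ := isPointed.Build tempered tempered0.

Definition cylinder_sets : set (set tempered) :=
  [set A | exists (f : schwartz_fun) (B : set (measurableTypeR R)),
     measurable B /\ A = [set w : tempered | B (w f)]].

Definition white_noise_space := g_sigma_algebraType cylinder_sets.

Definition L2normsq (f : R -> R) : \bar R :=
  (\int[leb]_x ((f x) ^+ 2)%:E)%E.

Definition white_noise_measure (P : probability white_noise_space R) : Prop :=
  forall f : schwartz_fun,
    \int[P]_w cos ((w : tempered) f) = expR (- (fine (L2normsq f) / 2)) /\
    \int[P]_w sin ((w : tempered) f) = 0.

End Schwartz.
Arguments schwartz_fun : clear implicits.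
Arguments tempered : clear implicits.
Arguments white_noise_space : clear implicits.

Section Operators.
Context {R : realType}.
Local Notation leb := (@lebesgue_measure R).

Definition regular_tempered (f : R -> R) : Prop :=
  measurable_fun setT f /\
  forall psi : schwartz_fun R,
    leb.-integrable setT (EFin \o (fun x => f x * psi x)).

Definition distr_derivative (F g : R -> R) : Prop :=
  [/\ regular_tempered F, regular_tempered g
    & forall psi : schwartz_fun R,
        \int[leb]_x (F x * derive1 psi x)
        = - \int[leb]_x (g x * psi x)].

Definition conv_minus (k f : R -> R) (x : R) : R :=
  \int[leb]_(t in `]x, +oo[) (f t * k (t - x)).

Definition conv_plus (k f : R -> R) (x : R) : R :=
  \int[leb]_(t in `]-oo, x[) (f t * k (x - t)).

Definition norm_const (k : R -> R) : R :=
  (\int[leb]_u ((k (Num.max (1 - u) 0) - k (Num.max (- u) 0)) ^+ 2))^-1.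

Inductive kernel_choice := KernelNu | KernelKappa.

(* M_-^(phi) f = g.  For the nu-kernel the distribution D_-^(nu) f is required
   to be (represented by) a function, which is determined almost everywhere. *)
Definition M_minus (c : kernel_choice) (nubar kappa f g : R -> R) : Prop :=
  match c with
  | KernelNu => let nu := levy_tail nubar in
      exists2 g0, distr_derivative (conv_minus nu f) (fun x => - g0 x)
        & forall x, g x = Num.sqrt (norm_const nu) * g0 x
  | KernelKappa =>
      forall x, g x = Num.sqrt (norm_const (primitive kappa))
                      * conv_minus kappa f x
  end.

(* M_+^(phi) f = g.  Evaluation at a point is meaningful because the continuous
   representative of the distributional derivative is selected. *)
Definition M_plus (c : kernel_choice) (nubar kappa f g : R -> R) : Prop :=
  match c with
  | KernelNu => let nu := levy_tail nubar in
      exists2 g0, continuous g0 /\ distr_derivative (conv_plus nu f) g0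
        & forall x, g x = Num.sqrt (norm_const nu) * g0 x
  | KernelKappa =>
      forall x, g x = Num.sqrt (norm_const (primitive kappa))
                      * conv_plus kappa f x
  end.

Definition M_plusC (c : kernel_choice) (nubar kappa : R -> R)
    (xi g : R -> R[i]) : Prop :=
  M_plus c nubar kappa (fun x => complex.Re (xi x)) (fun x => complex.Re (g x))
  /\
  M_plus c nubar kappa (fun x => complex.Im (xi x)) (fun x => complex.Im (g x)).

End Operators.

Section HarmonicOscillator.
Context {R : realType}.
Local Notation leb := (@lebesgue_measure R).

Definition sqmod (z : R[i]) : R := complex.Re z ^+ 2 + complex.Im z ^+ 2.

Definition schwartzC (xi : R -> R[i]) : Prop :=
  schwartz (fun x => complex.Re (xi x)) /\ schwartz (fun x => complex.Im (xi x)).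

Definition deriveC (f : R -> R[i]) (x : R) : R[i] :=
  derive1 (fun y => complex.Re (f y)) x +i* derive1 (fun y => complex.Im (f y)) x.

Definition oscillator (f : R -> R[i]) (x : R) : R[i] :=
  - deriveC (deriveC f) x + (x ^+ 2)%:C * f x + f x.

Definition normsq (p : nat) (xi : R -> R[i]) : \bar R :=
  (\int[leb]_x (sqmod (iter p oscillator xi x))%:E)%E.

Definition U_nbhd (p q : nat) : set (R -> R[i]) :=
  [set xi | schwartzC xi /\ ((2 ^+ q)%:E * normsq p xi < 1)%E].

(* R^n is n.-tuple R, with the product sigma-algebra. *)
Definition Rn (n : nat) := n.-tuple (measurableTypeR R).

(* Integral of a nonnegative measurable function against Lebesgue measure on
   R^n, as an iterated integral. *)
Fixpoint integraln (n : nat) : (Rn n -> \bar R) -> \bar R :=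
  match n return (Rn n -> \bar R) -> \bar R with
  | 0 => fun f => f [tuple]
  | n'.+1 => fun f =>
      (\int[leb]_x integraln (fun v : Rn n' => f [tuple of x :: v]))%E
  end.

Definition Rintegraln (n : nat) (f : Rn n -> R) : R :=
  fine (integraln (fun v => (Num.max (f v) 0)%:E)) -
  fine (integraln (fun v => (Num.max (- f v) 0)%:E)).

Definition Cintegraln (n : nat) (f : Rn n -> R[i]) : R[i] :=
  Rintegraln (fun v => complex.Re (f v)) +i*
  Rintegraln (fun v => complex.Im (f v)).

Definition L2Cn (n : nat) (f : Rn n -> R[i]) : Prop :=
  [/\ measurable_fun [set: Rn n] (fun v => complex.Re (f v) : measurableTypeR R),
      measurable_fun [set: Rn n] (fun v => complex.Im (f v) : measurableTypeR R)
    & (integraln (fun v => (sqmod (f v))%:E) < +oo)%E].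

Definition set_coord (n : nat) (v : Rn n) (i : 'I_n) (s : R) : Rn n :=
  [tuple if j == i then (s : measurableTypeR R) else tnth v j | j < n].

Definition partial (n : nat) (i : 'I_n) (f : Rn n -> R) (v : Rn n) : R :=
  derive1 (fun s : R => f (set_coord v i s)) (tnth v i).

Definition partials (n : nat) (s : seq 'I_n) (f : Rn n -> R) : Rn n -> R :=
  foldr (fun i g => partial i g) f s.

Definition schwartzn (n : nat) (f : Rn n -> R) : Prop :=
  (forall (s : seq 'I_n) (i : 'I_n) (v : Rn n),
     derivable (fun x : R => partials s f (set_coord v i x)) (tnth v i) 1) /\
  (forall (s : seq 'I_n) (k : 'I_n -> nat), exists M : R, forall v : Rn n,
     `|(\prod_(i < n) (tnth v i : R) ^+ k i) * partials s f v| <= M).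

Definition schwartzCn (n : nat) (f : Rn n -> R[i]) : Prop :=
  schwartzn (fun v => complex.Re (f v)) /\ schwartzn (fun v => complex.Im (f v)).

Definition partialC (n : nat) (i : 'I_n) (f : Rn n -> R[i]) (v : Rn n) : R[i] :=
  partial i (fun w => complex.Re (f w)) v +i*
  partial i (fun w => complex.Im (f w)) v.

Definition oscillator_at (n : nat) (i : 'I_n) (f : Rn n -> R[i]) (v : Rn n)
    : R[i] :=
  - partialC i (partialC i f) v + ((tnth v i : R) ^+ 2)%:C * f v + f v.

(* A^{\otimes n} is the composition of the oscillators in each coordinate. *)
Definition oscillatorn (n : nat) (f : Rn n -> R[i]) : Rn n -> R[i] :=
  foldr (fun i g => oscillator_at i g) f (enum 'I_n).

Definition tensor_pow (n : nat) (xi : R -> R[i]) (v : Rn n) : R[i] :=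
  \prod_(i < n) xi (tnth v i).

Definition permute (n : nat) (s : 'S_n) (v : Rn n) : Rn n :=
  [tuple tnth v (s i) | i < n].

Definition symmetricn (n : nat) (f : Rn n -> R[i]) : Prop :=
  forall (s : 'S_n) v, f (permute s v) = f v.

End HarmonicOscillator.
Arguments Rn : clear implicits.

Section KondratievSpace.
Context {R : realType}.

Definition functionaln (n : nat) := (Rn R n -> R[i]) -> R[i].

(* Squared norm |(A^{-p})^{\otimes n} T|^2 in L^2(R^n) of a distribution T:
   G = (A^{-p})^{\otimes n} T means <T, f> = <G, (A^p)^{\otimes n} f> for all
   Schwartz f; G is unique a.e. if it exists in L^2, and the infimum is +oo
   otherwise. *)
Definition dual_normsq (p n : nat) (T : functionaln n) : \bar R :=
  ereal_inf [set integraln (fun v => (sqmod (G v))%:E) | G in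
    [set G : Rn R n -> R[i] | L2Cn G /\
       forall f, schwartzCn f ->
         T f = Cintegraln (fun v => G v * iter p (@oscillatorn R n) f v)]].

Definition gen_chaos := forall n : nat, functionaln n.

Definition gc_lin (a b : R[i]) (Phi Psi : gen_chaos) : gen_chaos :=
  fun n f => a * Phi n f + b * Psi n f.

(* Squared norm of (L^2_{-p})^{-1}_{-q}. *)
Definition chaos_normsq (p q : nat) (Phi : gen_chaos) : \bar R :=
  (\sum_(0 <= n <oo) ((2 ^+ (n * q))^-1)%:E * dual_normsq p (Phi n))%E.

(* (S)^{-1}.  The values of Phi^(n) outside the Schwartz space are normalised
   to 0, so that equality in (S)^{-1} is equality in gen_chaos. *)
Definition Sm1 : set gen_chaos := [set Phi |
  [/\ forall n (a b : R[i]) f g, schwartzCn f -> schwartzCn g ->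
        Phi n (fun v => a * f v + b * g v) = a * Phi n f + b * Phi n g,
      forall n (s : 'S_n) f, schwartzCn f ->
        Phi n (fun v => f (permute s v)) = Phi n f,
      forall n f, ~ schwartzCn f -> Phi n f = 0
    & exists p q, (chaos_normsq p q Phi < +oo)%E]].

Definition absolutely_convex (V : set gen_chaos) : Prop :=
  forall (a b : R[i]) Phi Psi, V Phi -> V Psi -> `|a| + `|b| <= 1 ->
    V (gc_lin a b Phi Psi).

(* Neighbourhood base at 0 of the locally convex inductive limit topology:
   absolutely convex sets whose trace on each (L^2_{-p})^{-1}_{-q} is a
   neighbourhood of 0 there. *)
Definition Sm1_nbhs0_base : set (set gen_chaos) := [set V |
  [/\ V `<=` Sm1, absolutely_convex V
    & forall p q, exists2 r : R, 0 < r &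
        forall Phi, Sm1 Phi -> (chaos_normsq p q Phi < r%:E)%E -> V Phi]].

Definition Sm1_cvg (D : R -> gen_chaos) (F : set_system R) (N : gen_chaos)
    : Prop :=
  forall V, Sm1_nbhs0_base V -> F [set h | V (gc_lin 1 (-1) (D h) N)].

Definition diff_quotient (Y : R -> gen_chaos) (t h : R) : gen_chaos :=
  gc_lin (h^-1)%:C (- (h^-1)%:C) (Y (t + h)) (Y t).

(* (S Phi)(xi) = z, the chaos series being convergent. *)
Definition S_transform (Phi : gen_chaos) (xi : R -> R[i]) (z : R[i]) : Prop :=
  (series (fun n => complex.Re (Phi n (tensor_pow xi))) : R^nat) @ \oo
     --> complex.Re z /\
  (series (fun n => complex.Im (Phi n (tensor_pow xi))) : R^nat) @ \oo
     --> complex.Im z.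

End KondratievSpace.
Arguments functionaln : clear implicits.
Arguments gen_chaos : clear implicits.

Section WhiteNoise.
Context {R : realType}.
Local Notation leb := (@lebesgue_measure R).
Local Notation Omega := (white_noise_space R).
Context (P : probability Omega R).

Definition L2mu (F : Omega -> R[i]) : Prop :=
  [/\ measurable_fun setT (fun w => complex.Re (F w)),
      measurable_fun setT (fun w => complex.Im (F w))
    & (\int[P]_w (sqmod (F w))%:E < +oo)%E].

Definition L2mu_cvg (F_ : nat -> Omega -> R[i]) (F : Omega -> R[i]) : Prop :=
  (\int[P]_w (sqmod (F_ k w - F w))%:E)%E @[k --> \oo] --> (0 : \bar R)%E.

(* F is the L^2(mu)-extension <omega, g> of the dual pairing to g in L^2(R). *)
Definition L2_pairing (g : R -> R) (F : Omega -> R) : Prop :=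
  [/\ Lp_on 2 setT g, L2mu (fun w => (F w)%:C)
    & exists xi : nat -> schwartz_fun R,
        (L2normsq (fun x => xi k x - g x) @[k --> \oo] --> (0 : \bar R)%E) /\
        L2mu_cvg (fun k w => ((w : tempered R) (xi k))%:C) (fun w => (F w)%:C)].

(* Hermite polynomial of degree n with parameter s:
   <:omega^{\otimes n}:, xi^{\otimes n}> is its value at x = <omega, xi> for
   s = |xi|_{L^2}^2. *)
Fixpoint hermite (s x : R) (n : nat) : R :=
  match n with
  | 0 => 1
  | n1.+1 => match n1 with
             | 0 => x
             | n2.+1 => x * hermite s x n1 - n1%:R * s * hermite s x n2
             end
  end.

Definition wick (n : nat) (xi : schwartz_fun R) (w : tempered R) : R :=
  hermite (fine (L2normsq xi)) (w xi) n.

(* Y = <:omega^{\otimes n}:, f>, the continuous extension to symmetric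
   f in L^2_C(R^n) from linear combinations of tensor powers xi^{\otimes n}. *)
Definition wick_integral (n : nat) (f : Rn R n -> R[i]) (Y : Omega -> R[i])
    : Prop :=
  [/\ L2Cn f, symmetricn f, L2mu Y
    & exists comb : nat -> seq (R[i] * schwartz_fun R),
        (integraln (fun v => (sqmod
           (\sum_(cx <- comb k) cx.1 * tensor_pow (fun x => (cx.2 x)%:C) v
            - f v))%:E) @[k --> \oo] --> (0 : \bar R)%E) /\
        L2mu_cvg (fun k w =>
           \sum_(cx <- comb k) cx.1 * (wick n cx.2 w)%:C) Y].

Definition chaos_decomposition (F : Omega -> R[i])
    (f : forall n, Rn R n -> R[i]) : Prop :=
  L2mu F /\
  exists Y : nat -> Omega -> R[i],
    (forall n, wick_integral (f n) (Y n)) /\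
    L2mu_cvg (fun N w => \sum_(n < N) Y n w) F.

(* The inclusion of (L^2) in (S)^{-1} through the chaos decomposition. *)
Definition L2_in_Sm1 (F : Omega -> R[i]) (Phi : gen_chaos R) : Prop :=
  Sm1 Phi /\
  exists2 f : forall n, Rn R n -> R[i], chaos_decomposition F f &
    forall n g, schwartzCn g -> Phi n g = Cintegraln (fun v => f n v * g v).

(* F = X_phi(f) = <omega, M_-^(phi) f>. *)
Definition X_phi (c : kernel_choice) (nubar kappa f : R -> R) (F : Omega -> R)
    : Prop :=
  exists2 g, M_minus c nubar kappa f g & L2_pairing g F.

End WhiteNoise.

(* Main.v *)
From HB Require Import structures.
Require Import Defs.
From mathcomp Require Import measurable_realfun ring lra.

Set Implicit Arguments.
Unset Strict Implicit.
Unset Printing Implicit Defensive.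

(** All the objects live in the first chaos.  Let k be the kernel (nu or
    kappa, extended by 0 to x <= 0) and j its order (1 for nu, 0 for kappa).
    On test functions, X_t acts by f |-> int (int_0^t k(s - x) ds) f^(j)(x) dx
    and its candidate derivative N_t by f |-> int k(t - x) f^(j)(x) dx, which
    is (M_+ f)(t); both up to the normalising constant.  Since k is
    nonincreasing, the density of (X_(t+h) - X_t)/h - N_t has L^1-norm at most
    3 int_0^|h| k, which tends to 0.

    It remains to see that f |-> int psi f^(j), for psi in L^1 + L^oo, is of
    the form f |-> int G (A f) with |G|_2 controlled by |psi|_1.  The
    oscillator A = - D^2 + x^2 + 1 annihilates u(x) = e^(x^2/2) int_(-oo)^x
    e^(-s^2) ds and its reflection, so its Green kernel is explicit: there is
    H_j with f^(j)(y) = int H_j(y, x) (A f)(x) dx and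
    |H_j(y, x)| <= C e^(- |x - y| (1 + |x|) / 8).  Hence G(x) = int psi(y)
    H_j(y, x) dy, and convergence takes place in the Hilbert space with
    p = 1 and q = 0. *)

(** * Invariance of Lebesgue measure *)

(** Since [k] may be merely integrable at 0, a small L^1-norm of psi has to control |G|_2 by itself.
    It does because H_j is bounded and its integral in x is bounded uniformly in y: both |G|_oo and
    |G|_1 are then at most constant multiples of |psi|_1, and |G|_2^2 <= |G|_oo |G|_1. For the
    bounded part of psi this argument fails, and the factor 1 + |x| in the exponent takes over:
    around x the kernel has width of order 1 / (1 + |x|) in y, so a bounded psi gives G(x) = O(1 /
    (1 + |x|)), which is square integrable. The two kernels can share one proof because the
    derivative always sits on the test function: the minus sign of D_- cancels against that of the
    integration by parts, and D_+ differentiates the smooth factor of the convolution. The constant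
    3 counts three pieces: to the left of both endpoints, an average of k and an endpoint value lie
    between the same two values of k, whose gap telescopes; between the endpoints, the average and
    the value are estimated separately. *)

Section LebesgueReflection.
Context {R : realType}.
Local Notation leb := (@lebesgue_measure R).

Definition reflect_at (c : R) (x : measurableTypeR R) : measurableTypeR R := c - x.

Lemma measurable_reflect_at (c : R) : measurable_fun setT (reflect_at c).
Proof. by apply: measurable_funB => //; exact: measurable_cst. Qed.

HB.instance Definition _ (c : R) :=
  isMeasurableFun.Build _ _ _ _ (reflect_at c) (measurable_reflect_at c).

Lemma lebesgue_measure_reflect (c : R) (A : set R) : measurable A ->
  pushforward leb (reflect_at c) A = leb A.
Proof.
move=> mA; apply/esym/lebesgue_measure_unique => //= _ [[a b]] _ <-.
rewrite /pushforward.
have -> : (reflect_at c) @^-1` `]a, b] = `[c - b, c - a[%classic.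
  by apply/seteqP; split => x /=; rewrite /reflect_at !in_itv/= => /andP[? ?];
     apply/andP; split; lra.
rewrite !lebesgue_measure_itv/= !lte_fin ltrD2l ltrN2.
by case: ifP => // _; rewrite -EFinD; congr EFin; lra.
Qed.

Lemma ge0_integral_reflect (c : R) (f : R -> \bar R) :
  measurable_fun setT f -> (forall x, 0 <= f x)%E ->
  (\int[leb]_x f (c - x)%R = \int[leb]_x f x)%E.
Proof.
move=> mf f0.
rewrite [RHS](eq_measure_integral (pushforward leb (reflect_at c))).
  by rewrite ge0_integral_pushforward.
by move=> A mA _; exact/esym/lebesgue_measure_reflect.
Qed.

(** Translation by [c] is [reflect_at 0] followed by [reflect_at c]. *)
Lemma ge0_integral_shift (c : R) (f : R -> \bar R) :
  measurable_fun setT f -> (forall x, 0 <= f x)%E ->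
  (\int[leb]_x f (x + c)%R = \int[leb]_x f x)%E.
Proof.
move=> mf f0.
rewrite -(@ge0_integral_reflect c f)//.
rewrite -(@ge0_integral_reflect 0 (fun x => f (c - x)%R))//; last first.
  exact: (measurableT_comp mf (measurable_reflect_at c)).
by apply: eq_integral => x _; congr f; ring.
Qed.

Lemma integral_reflect (c : R) (f : R -> \bar R) :
  measurable_fun setT f ->
  (\int[leb]_x f (c - x)%R = \int[leb]_x f x)%E.
Proof.
move=> mf; rewrite integralE [RHS]integralE.
congr (_ - _)%E.
  rewrite -(@ge0_integral_reflect c (f^\+)%E (measurable_funepos mf) (funepos_ge0 f)).
  by apply: eq_integral => x _; rewrite !funeposE.
rewrite -(@ge0_integral_reflect c (f^\-)%E (measurable_funeneg mf) (funeneg_ge0 f)).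
by apply: eq_integral => x _; rewrite !funenegE.
Qed.

Lemma Rintegral_reflect (c : R) (f : R -> R) : measurable_fun setT f ->
  \int[leb]_x f (c - x) = \int[leb]_x f x.
Proof.
move=> mf; congr fine.
by apply: (@integral_reflect c (EFin \o f)); exact/measurable_EFinP.
Qed.

Lemma integrable_reflect (c : R) (f : R -> R) :
  leb.-integrable setT (EFin \o f) ->
  leb.-integrable setT (EFin \o (fun x => f (c - x))).
Proof.
move=> /integrableP[/measurable_EFinP mf foo]; apply/integrableP; split.
  by apply/measurable_EFinP; exact: (measurableT_comp mf (measurable_reflect_at c)).
rewrite (@ge0_integral_reflect c (fun x => `|(f x)%:E|)%E)//.
by apply: measurableT_comp => //; exact/measurable_EFinP.
Qed.

(** By translation and symmetry this is twice a half-line integral, which is [a^-1] times the total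
    mass of the exponential density. *)
Lemma ge0_integral_expR_norm (a y : R) : 0 < a ->
  (\int[leb]_x (expR (- (a * `|x - y|)))%:E = (2 / a)%:E)%E.
Proof.
move=> a0.
have ce : continuous (fun x : R => expR (- (a * `|x|))).
  move=> x; apply: continuous_comp; last exact: continuous_expR.
  by apply: continuousN; apply: continuousM; [exact: cst_continuous|exact: norm_continuous].
have -> : (\int[leb]_x (expR (- (a * `|x - y|)))%:E = \int[leb]_x (expR (- (a * `|x|)))%:E)%E.
  apply: (@ge0_integral_shift (- y) (fun x => (expR (- (a * `|x|)))%:E)).
    by apply/measurable_EFinP; exact: continuous_measurable_fun.
  by move=> x; rewrite lee_fin expR_ge0.
rewrite (@ge0_symfun_integralT _ (fun x => expR (- (a * `|x|))))//.
- have -> : [set x : R | 0 <= x] = `[0, +oo[%classic.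
    by apply/seteqP; split => x/=; rewrite in_itv/= andbT.
  have <- : (\int[leb]_x ((a^-1)%:E * (exponential_pdf a x)%:E) =
           \int[leb]_(x in `[0%R, +oo[) (expR (- (a * `|x|)))%:E)%E.
    rewrite [RHS]integral_mkcond; apply: eq_integral => x _.
    rewrite /exponential_pdf !patchE; case: ifPn; last by rewrite mule0.
    rewrite inE/= in_itv/= andbT => x0; rewrite -EFinM ger0_norm// mulrA mulVf ?gt_eqF//.
    by rewrite mul1r mulNr.
  rewrite ge0_integralZl//; last 3 first.
    by apply/measurable_EFinP; exact: measurable_exponential_pdf.
    by move=> x _; rewrite lee_fin exponential_pdf_ge0// ltW.
    by rewrite lee_fin invr_ge0 ltW.
  by rewrite integral_exponential_pdf// mule1 -EFinM.
- by move=> x/=; rewrite normrN.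
Qed.

(** This function serves as the common majorant in all decay estimates for Schwartz functions. *)
Lemma integrable_oneDsqrV :
  leb.-integrable setT (EFin \o (fun x : R => (1 + x ^+ 2)^-1)).
Proof.
have m : measurable_fun setT (fun x : R => (1 + x ^+ 2)^-1).
  by apply: continuous_measurable_fun; exact: continuous_oneDsqrV.
have p (x : R) : 0 <= (1 + x ^+ 2)^-1 by rewrite invr_ge0 addr_ge0 ?sqr_ge0.
apply/integrableP; split; first exact/measurable_EFinP.
under eq_integral => x _ do rewrite /= ger0_norm//.
rewrite (@ge0_symfun_integralT _ (fun x => (1 + x ^+ 2)^-1))//.
- have -> : [set x : R | 0 <= x] = `[0, +oo[%classic.
    by apply/seteqP; split => x/=; rewrite in_itv/= andbT.
  by rewrite integral0y_oneDsqr -EFinM ltry.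
- exact: continuous_oneDsqrV.
- by move=> x/=; rewrite sqrrN.
Qed.

End LebesgueReflection.

(** * The fundamental theorem of calculus on half-lines *)

Section HalfLineFTC.
Context {R : realType}.
Local Notation leb := (@lebesgue_measure R).

Lemma measurable_patch (D : set R) (f : R -> R) : measurable D ->
  measurable_fun setT f -> measurable_fun setT (f \_ D).
Proof. by move=> mD mf; apply/(measurable_restrictT f mD); exact: measurable_funS mf. Qed.

Lemma integrable_patch (D : set R) (f : R -> R) : measurable D ->
  leb.-integrable D (EFin \o f) <-> leb.-integrable setT (EFin \o (f \_ D)).
Proof. by move=> mD; rewrite -restrict_EFin -integrable_mkcond. Qed.

(** On []y, n]] the integral is [Q n - Q y]; dominated convergence then passes to the half-line
    along the integers. *)
Lemma Rintegral_itvoy_derive (Q g : R -> R) (y : R) :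
  (forall x, is_derive x (1 : R) Q (g x)) -> continuous g ->
  leb.-integrable `]y, +oo[ (EFin \o g) ->
  Q n%:R @[n --> \oo] --> (0 : R) ->
  \int[leb]_(x in `]y, +oo[) g x = - Q y.
Proof.
move=> dQ cg ig Q0.
have mg : measurable_fun setT g by exact: continuous_measurable_fun.
have Q' : derive1 Q = g by apply/funext => x; rewrite derive1E; apply: derive_val.
have dQ' x : derivable Q x 1 by have [] := dQ x.
have cQ x : {for x, continuous Q}.
  by apply: differentiable_continuous; apply/derivable1_diffP.
pose f_ (n : nat) x := ((g \_ `]y, n%:R]) x)%:E.
have Hd : (\int[leb]_x f_ n x)%E @[n --> \oo] --> (\int[leb]_x ((g \_ `]y, +oo[) x)%:E)%E.
  apply: (@dominated_cvg _ _ _ leb setT measurableT f_ _ (fun x => `|(g \_ `]y, +oo[) x|%:E)).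
  - by move=> n; apply/measurable_EFinP; exact: measurable_patch.
  - move=> x _; apply/cvg_EFin; first exact: nearW.
    apply: cvg_near_cst.
    near=> n; rewrite !patchE.
    have xn : x <= n%:R by near: n; exact: nbhs_infty_ger.
    by rewrite /f_ /= !patchE !mem_setE !in_itv/= andbT xn andbT.
  - by [].
  - have igT : leb.-integrable setT (EFin \o (g \_ `]y, +oo[)).
      exact: (integrable_patch g (measurable_itv _)).1.
    exact: (integrable_norm igT).
  - move=> n x _; rewrite /f_ !patchE !mem_setE !in_itv/= andbT lee_fin.
    by case: (y < x) => //=; case: ifP => // _; rewrite normr0.
have Hc : (\int[leb]_x f_ n x)%E @[n --> \oo] --> (- Q y)%:E.
  apply: (@cvg_trans _ ((Q n%:R - Q y)%:E @[n --> \oo])).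
    apply: near_eq_cvg; near=> n.
    have yn : y < n%:R by near: n; exact: nbhs_infty_gtr.
    transitivity (\int[leb]_(x in `]y, n%:R]) (g x)%:E)%E; last first.
      by rewrite integral_mkcond; apply: eq_integral => x _; rewrite /f_ !patchE; case: ifP.
    rewrite integral_itv_obnd_cbnd; last first.
      by apply/measurable_EFinP; exact: measurable_funTS.
    rewrite (@continuous_FTC2 _ g Q)//.
    - exact: continuous_subspaceT.
    - split.
      + by move=> x _.
      + exact/cvg_at_right_filter/cQ.
      + exact/cvg_at_left_filter/cQ.
    - by move=> x _; rewrite Q'.
  apply/cvg_EFin; first exact: nearW.
  rewrite -[X in _ --> X]add0r; apply: cvgB => //; exact: cvg_cst.
rewrite Rintegral_mkcond /Rintegral.
by rewrite (cvg_unique _ Hd Hc).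
Unshelve. all: by end_near. Qed.

(** The reflection of the line reduces this to the other half-line, with primitive [- Q (- x)]. *)
Lemma Rintegral_itvNyc_derive (Q g : R -> R) (y : R) :
  (forall x, is_derive x (1 : R) Q (g x)) -> continuous g ->
  leb.-integrable `]-oo, y] (EFin \o g) ->
  Q (- n%:R) @[n --> \oo] --> (0 : R) ->
  \int[leb]_(x in `]-oo, y]) g x = Q y.
Proof.
move=> dQ cg ig Q0.
have mg : measurable_fun setT g by exact: continuous_measurable_fun.
rewrite -Rintegral_itv_bndo_bndc; last first.
  by apply: integrableS ig => // x /=; rewrite !in_itv/= => /ltW.
rewrite Rintegral_mkcond -(@Rintegral_reflect _ 0); last exact: measurable_patch.
transitivity (\int[leb]_(x in `](- y), +oo[) g (- x)).
  rewrite [RHS]Rintegral_mkcond; apply: eq_Rintegral => x _.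
  rewrite !patchE !mem_setE !in_itv/= sub0r andbT ltrNl.
  by case: ifP.
have dQN x : is_derive x (1 : R) (fun x => - Q (- x)) (g (- x)).
  have dN : is_derive x (1 : R) (fun x : R => - x) (-1) by apply: is_deriveN.
  have := @is_derive1_comp _ Q (fun x => - x) x _ _ (dQ (- x)) dN.
  by rewrite mulrN1 => /is_deriveN; rewrite opprK.
have cgN : continuous (fun x : R => g (- x)).
  move=> x; apply: (@continuous_comp _ _ _ (fun x : R => - x)) ; last exact: cg.
  exact: opp_continuous.
have igN : leb.-integrable `](- y), +oo[ (EFin \o (fun x : R => g (- x))).
  apply: (integrable_patch _ (measurable_itv _)).2.
  have ig' : leb.-integrable setT (EFin \o (g \_ `]-oo, y[)).
    apply: (integrable_patch g (measurable_itv _)).1.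
    by apply: integrableS ig => // x /=; rewrite !in_itv/= => /ltW.
  apply: eq_integrable (integrable_reflect 0 ig') => // x _.
  by rewrite /= !patchE !mem_setE !in_itv/= sub0r andbT ltrNl; case: ifP.
have QN0 : - Q (- n%:R) @[n --> \oo] --> (0 : R) by rewrite -oppr0; exact: cvgN.
by rewrite (Rintegral_itvoy_derive dQN cgN igN QN0) !opprK.
Qed.

End HalfLineFTC.

(** * Integrability rules for real-valued functions *)

Section RealIntegrable.
Context {R : realType}.
Local Notation leb := (@lebesgue_measure R).
Implicit Types (D : set (measurableTypeR R)) (f g : R -> R).

Lemma integrableZlR D (c : R) f : measurable D -> leb.-integrable D (EFin \o f) ->
  leb.-integrable D (EFin \o (fun x => c * f x)).
Proof. by move=> mD i; exact: (integrableZl mD c i). Qed.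

Lemma integrableDR D f g : measurable D -> leb.-integrable D (EFin \o f) ->
  leb.-integrable D (EFin \o g) -> leb.-integrable D (EFin \o (fun x => f x + g x)).
Proof. by move=> mD i j; exact: (integrableD mD i j). Qed.

Lemma integrableBR D f g : measurable D -> leb.-integrable D (EFin \o f) ->
  leb.-integrable D (EFin \o g) -> leb.-integrable D (EFin \o (fun x => f x - g x)).
Proof. by move=> mD i j; exact: (integrableB mD i j). Qed.

Lemma le_integrableR D f g : measurable D -> measurable_fun D f ->
  (forall x, D x -> `|f x| <= g x) -> leb.-integrable D (EFin \o g) ->
  leb.-integrable D (EFin \o f).
Proof.
move=> mD mf fg ig; apply: (le_integrable mD _ _ ig); first exact/measurable_EFinP.
by move=> x Dx /=; rewrite lee_fin (le_trans (fg x Dx))// ler_norm.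
Qed.

End RealIntegrable.

(** * Schwartz functions of one variable *)

Section SchwartzReal.
Context {R : realType}.
Local Notation leb := (@lebesgue_measure R).
Implicit Types phi psi : R -> R.

Lemma derive1nSr n phi : derive1n n.+1 phi = derive1n n (derive1 phi).
Proof. by rewrite /derive1n iterSr. Qed.

Lemma schwartz_derive1 phi : schwartz phi -> schwartz (derive1 phi).
Proof.
move=> [d b]; split=> [n x|n k]; first by rewrite -derive1nSr.
by have [M HM] := b n.+1 k; exists M => x; rewrite -derive1nSr.
Qed.

Lemma schwartz_derive1n n phi : schwartz phi -> schwartz (derive1n n phi).
Proof. by elim: n => // n ih /ih; rewrite derive1nS; exact: schwartz_derive1. Qed.

Lemma schwartz_is_derive phi (x : R) : schwartz phi ->
  is_derive x 1 phi (derive1 phi x).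
Proof. by move=> [d _]; rewrite derive1E; apply/derivableP; exact: (d 0%N). Qed.

Lemma schwartz_continuous phi : schwartz phi -> continuous phi.
Proof.
move=> [d _] x; apply: differentiable_continuous; apply/derivable1_diffP.
exact: (d 0%N).
Qed.

(** Add the seminorms with weights [x ^+ k] and [x ^+ k.+2]. *)
Lemma schwartz_decay phi (k : nat) : schwartz phi ->
  exists2 M : R, 0 <= M & forall x, `|x ^+ k * phi x| <= M * (1 + x ^+ 2)^-1.
Proof.
move=> [_ b]; have [M1 H1] := b 0%N k; have [M2 H2] := b 0%N k.+2.
exists (M1 + M2).
  by apply: addr_ge0; [exact: le_trans (normr_ge0 _) (H1 0)|exact: le_trans (normr_ge0 _) (H2 0)].
move=> x; rewrite ler_pdivlMr ?ltr_pwDl ?sqr_ge0//.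
rewrite mulrDr mulr1 lerD ?H1//.
rewrite -[x ^+ 2]ger0_norm ?sqr_ge0// -normrM.
by rewrite mulrAC -exprD addn2 H2.
Qed.

Lemma integrable_decay (f : R -> R) (M : R) : measurable_fun setT f ->
  (forall x, `|f x| <= M * (1 + x ^+ 2)^-1) -> leb.-integrable setT (EFin \o f).
Proof.
move=> mf fM.
exact: (le_integrableR measurableT mf (fun x _ => fM x)
         (integrableZlR M measurableT integrable_oneDsqrV)).
Qed.

(** The sequence [s] stands for [n] or [- n], so that both ends of the line are covered. Once n >= 1
    and n >= M / e, one has M <= n e <= n^2 e. *)
Lemma decay_cvg0 (f : R -> R) (M : R) (s : nat -> R) :
  (forall n, `|s n| = n%:R) ->
  (forall n, `|f (s n)| <= M * (1 + s n ^+ 2)^-1) -> f (s n) @[n --> \oo] --> (0 : R).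
Proof.
move=> sn fM.
have M0 : 0 <= M.
  have := le_trans (normr_ge0 _) (fM 0%N); rewrite pmulr_lge0//.
  by rewrite invr_gt0 ltr_pwDl ?sqr_ge0.
apply/cvgr0Pnorm_le => e e0; near=> n.
apply: (le_trans (fM _)).
rewrite -(ger0_norm (sqr_ge0 (s n))) normrX sn.
have n1 : (1 : R) <= n%:R by near: n; exact: nbhs_infty_ger.
have nM : M / e <= n%:R by near: n; exact: nbhs_infty_ger.
rewrite ler_pdivrMr; last by rewrite ltr_pwDl ?sqr_ge0.
have : M <= n%:R * e by rewrite -ler_pdivrMr.
by move=> ?; nra.
Unshelve. all: by end_near. Qed.

Lemma schwartz_integrable phi : schwartz phi -> leb.-integrable setT (EFin \o phi).
Proof.
move=> sphi; have [M _ HM] := schwartz_decay 0 sphi.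
apply: (@integrable_decay _ M) => [|x].
  by apply: continuous_measurable_fun; exact: schwartz_continuous.
by have := HM x; rewrite expr0 mul1r.
Qed.

Lemma derive1n_lincomb (a b : R) phi psi : schwartz phi -> schwartz psi ->
  forall n, derive1n n (fun x => a * phi x + b * psi x) =
    (fun x => a * derive1n n phi x + b * derive1n n psi x).
Proof.
move=> sphi spsi; elim=> // n ih; rewrite derive1nS ih; apply/funext => x.
have := schwartz_is_derive x (schwartz_derive1n n sphi).
have := schwartz_is_derive x (schwartz_derive1n n spsi).
rewrite -!derive1nS => d1 d2; rewrite derive1E.
by apply: derive_val.
Qed.

Lemma schwartz_lincomb (a b : R) phi psi : schwartz phi -> schwartz psi ->
  schwartz (fun x => a * phi x + b * psi x).
Proof.
move=> sphi spsi; have E := derive1n_lincomb a b sphi spsi.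
have [d1 b1] := sphi; have [d2 b2] := spsi.
split=> [n x|n k]; rewrite E.
  by apply: derivableD; apply: derivableM => //.
have [M1 H1] := b1 n k; have [M2 H2] := b2 n k.
exists (`|a| * M1 + `|b| * M2) => x.
rewrite mulrDr (le_trans (ler_normD _ _))// lerD// mulrCA normrM ler_wpM2l//.
Qed.

(** The oscillator has real coefficients, so it acts separately on real and imaginary parts; the
    analysis is done with this real version. *)
Definition osc (phi : R -> R) (x : R) : R :=
  - derive1n 2 phi x + x ^+ 2 * phi x + phi x.

Lemma continuous_osc phi : schwartz phi -> continuous (osc phi).
Proof.
move=> sphi x; rewrite /osc; apply: cvgD; last exact: schwartz_continuous.
apply: cvgD; first by apply: cvgN; exact/schwartz_continuous/schwartz_derive1n.
by apply: cvgM; [exact: exprn_continuous|exact: schwartz_continuous].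
Qed.

Lemma osc_decay phi : schwartz phi ->
  exists2 M : R, 0 <= M & forall x, `|osc phi x| <= M * (1 + x ^+ 2)^-1.
Proof.
move=> sphi.
have [M0 p0 H0] := schwartz_decay 0 sphi.
have [M2 p2 H2] := schwartz_decay 2 sphi.
have [M3 p3 H3] := schwartz_decay 0 (schwartz_derive1n 2 sphi).
exists (M3 + M2 + M0); first by rewrite !addr_ge0.
move=> x; rewrite /osc (le_trans (ler_normD _ _))// 2!mulrDl lerD//.
  rewrite (le_trans (ler_normD _ _))// lerD// normrN.
  by have := H3 x; rewrite expr0 mul1r.
by have := H0 x; rewrite expr0 mul1r.
Qed.

Lemma integrable_osc phi : schwartz phi -> leb.-integrable setT (EFin \o osc phi).
Proof.
move=> sphi; have [M _ HM] := osc_decay sphi.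
by apply: (integrable_decay _ HM); apply: continuous_measurable_fun; exact: continuous_osc.
Qed.

End SchwartzReal.

(** * The Green kernel of the harmonic oscillator *)

Section GreenKernel.
Context {R : realType}.
Local Notation leb := (@lebesgue_measure R).

Definition gaussNy (x : R) : R := \int[leb]_(s in `]-oo, x]) gauss_fun s.

Lemma is_derive_gaussNy (x : R) : is_derive x 1 gaussNy (gauss_fun x).
Proof.
have ig : leb.-integrable `]-oo, x + 1] (EFin \o @gauss_fun R).
  exact: (integrableS _ _ _ (@integrableT_gauss R)).
have [d e] := @continuous_FTC1 R (@gauss_fun R) -oo%O x (x + 1) (ltr_pwDr ltr01 (lexx x))
  ig (ltNyr _) (@continuous_gauss_fun R x).
apply: DeriveDef; first exact: d.
by rewrite -derive1E; exact: e.
Qed.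

Lemma gaussNy_ge0 (x : R) : 0 <= gaussNy x.
Proof. by apply: Rintegral_ge0 => s _; exact: gauss_fun_ge0. Qed.

(** The number sqrt pi. It returns as the Wronskian of the two solutions of A u = 0, hence as the
    normalisation of the Green kernel. *)
Definition gauss_mass : R := gaussNy 0 + gaussNy 0.

(** The derivative vanishes because the Gaussian is even, so the sum keeps its value at 0. *)
Lemma gaussNyD (x : R) : gaussNy x + gaussNy (- x) = gauss_mass.
Proof.
transitivity (gaussNy 0 + gaussNy (- 0)); last by rewrite oppr0.
apply: (@is_derive_0_is_cst _ (fun x => gaussNy x + gaussNy (- x))) => {}x.
have d1 := is_derive_gaussNy x.
have dN : is_derive x (1 : R) (fun x : R => - x) (-1) by apply: is_deriveN.
have := is_derive1_comp (is_derive_gaussNy (- x)) dN => d2.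
have := is_deriveD d1 d2.
by rewrite /gauss_fun sqrrN mulrN1 subrr.
Qed.

Lemma gauss_mass_gt0 : 0 < gauss_mass.
Proof.
suff p : 0 < gaussNy 0 by rewrite addr_gt0.
have -> : gaussNy 0 = Num.sqrt pi / 2.
  rewrite /gaussNy /Rintegral.
  suff -> : (\int[leb]_(s in `]-oo, 0%R]) (gauss_fun s)%:E =
     \int[leb]_(s in `[0%R, +oo[) (gauss_fun s)%:E)%E by rewrite integral0y_gauss.
  have /= -> := @ge0_integration_by_substitution0 _ (EFin \o @gauss_fun R).
  - by apply: eq_integral => x _; rewrite /= /gauss_fun sqrrN.
  - by apply/measurable_EFinP; exact: measurable_gauss_fun.
  - by move=> r; rewrite lee_fin gauss_fun_ge0.
by rewrite divr_gt0// sqrtr_gt0 pi_gt0.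
Qed.

Lemma gaussNy_le (x : R) : gaussNy x <= gauss_mass.
Proof. by rewrite -(gaussNyD x) lerDl gaussNy_ge0. Qed.

(* For s <= y < 0, completing the square gives
   - s^2 <= - y^2 - 2 |y| |s - y|. *)
Lemma gaussNy_tail (y : R) : y < 0 -> `|y| * gaussNy y <= gauss_fun y.
Proof.
move=> y0; rewrite ltr0_norm//.
have a0 : 0 < - 2 * y by lra.
suff H : ((gaussNy y)%:E <= (gauss_fun y)%:E * (2 / (- 2 * y))%:E)%E.
  move: H; rewrite -EFinM lee_fin => H.
  have : - y * gaussNy y <= - y * (gauss_fun y * (2 / (-2 * y))).
    by rewrite ler_wpM2l//; lra.
  by move/le_trans; apply; rewrite le_eqVlt; apply/orP; left; apply/eqP; field; lra.
rewrite -(ge0_integral_expR_norm y a0).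
rewrite -ge0_integralZl//; last 2 first.
- apply/measurable_EFinP; apply: measurableT_comp => //.
  apply: measurableT_comp => //; apply: measurable_funM => //.
  by apply: measurableT_comp => //; exact: measurable_funB.
- by rewrite lee_fin gauss_fun_ge0.
rewrite /gaussNy /Rintegral fineK; last first.
  apply: integrable_fin_num => //.
  by apply: (integrableS measurableT _ _ (@integrableT_gauss R)).
rewrite integral_mkcond; apply: ge0_le_integral => //.
- by move=> x _; rewrite erestrict_ge0// => t _; rewrite lee_fin gauss_fun_ge0.
- apply/(measurable_restrictT _ _).1 => //; apply/measurable_EFinP.
  by apply: measurable_funTS; exact: measurable_gauss_fun.
- apply: measurable_funeM; apply/measurable_EFinP; apply: measurableT_comp => //.
  apply: measurableT_comp => //; apply: measurable_funM => //.
  by apply: measurableT_comp => //; exact: measurable_funB.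
- move=> x _; rewrite patchE; case: ifPn => [|_]; last first.
    by rewrite mule_ge0// lee_fin ?gauss_fun_ge0 ?expR_ge0.
  rewrite inE/= in_itv/= => xy.
  rewrite -EFinM lee_fin /gauss_fun -expRD ler_expR ler0_norm; last by lra.
  by nra.
Qed.

(** The summand 2 serves y <= -1, where 1 - y <= 2 |y|; the other one serves -1 < y <= 0, where 1 -
    y <= 2 and the Gaussian is at least 1 / e. *)
Definition gaussC : R := 2 + expR 1 * gauss_mass * 2.

Lemma gaussC_ge2 : 2 <= gaussC.
Proof. by rewrite lerDl !mulr_ge0 ?expR_ge0 ?(ltW gauss_mass_gt0). Qed.

(** The gain 1 - y over the plain Gaussian bound is essential: it later absorbs the growth factor 1
    + x of [dum] on the positive side. *)
Lemma gaussNy_bound (y : R) : y <= 0 -> (1 - y) * gaussNy y <= gaussC * gauss_fun y.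
Proof.
move=> y0; have g0 := gauss_mass_gt0; have F0 := gaussNy_ge0 y.
have G0 := gauss_fun_ge0 y; have Fm := gaussNy_le y; rewrite /gaussC.
have e0 : 0 <= expR 1 * gauss_mass by rewrite mulr_ge0 ?expR_ge0// ltW.
have [y1|y1] := lerP y (-1).
  have := @gaussNy_tail y; rewrite ler0_norm// => H.
  have {}H : - y * gaussNy y <= gauss_fun y by apply: H; lra.
  have : gaussNy y <= - y * gaussNy y by nra.
  by have := mulr_ge0 e0 G0; nra.
have gy : 1 <= expR 1 * gauss_fun y.
  rewrite /gauss_fun -expRD -[leLHS]expR0 ler_expR; nra.
have : (1 - y) * gaussNy y <= 2 * gauss_mass.
  by apply: ler_pM => //; lra.
move/le_trans; apply.
have : 2 * gauss_mass <= 2 * (gauss_mass * (expR 1 * gauss_fun y)).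
  by rewrite ler_pM2l// ler_peMr// ltW.
by lra.
Qed.

(* [um] solves A u = 0 and decays at -oo; x |-> um (- x) is the solution
   decaying at +oo. *)
Definition um (x : R) : R := expR (x ^+ 2 / 2) * gaussNy x.
Definition dum (x : R) : R := x * um x + expR (- (x ^+ 2 / 2)).

Lemma is_derive_expR_sqr (c x : R) :
  is_derive x 1 (fun x : R => expR (c * x ^+ 2)) (2 * c * x * expR (c * x ^+ 2)).
Proof.
have d : is_derive x 1 (fun x : R => c * x ^+ 2) (2 * c * x).
  have di := is_derive_id x (1 : R).
  have := is_deriveM (is_derive_cst c x 1) (is_deriveM di di).
  by move/is_derive_eq; apply; rewrite /GRing.scale/=; ring.
have := @is_derive1_comp _ expR (fun x => c * x ^+ 2) x _ _ (is_derive_expR (c * x ^+ 2)) d.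
by move/is_derive_eq; apply; ring.
Qed.

Lemma is_derive_um (x : R) : is_derive x 1 um (dum x).
Proof.
have d1 := is_derive_expR_sqr 2^-1 x.
have := is_deriveM d1 (is_derive_gaussNy x).
have -> : (fun x : R => expR (2^-1 * x ^+ 2)) * gaussNy = um.
  by apply/funext => z; rewrite /um [X in expR X]mulrC.
move/is_derive_eq; apply; rewrite /GRing.scale/= /dum /um /gauss_fun.
have -> : - (x ^+ 2 / 2) = 2^-1 * x ^+ 2 + - x ^+ 2 by field.
rewrite expRD [x ^+ 2 / 2]mulrC addrC; congr (_ + _).
by field.
Qed.

(** This is the equation u'' = (x^2 + 1) u, that is, A u = 0. *)
Lemma is_derive_dum (x : R) : is_derive x 1 dum ((x ^+ 2 + 1) * um x).
Proof.
have d1 := is_derive_expR_sqr (- 2^-1) x.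
have d2 := is_deriveM (is_derive_id x (1:R)) (is_derive_um x).
have := is_deriveD d2 d1.
have -> : id * um + (fun x : R => expR (- 2^-1 * x ^+ 2)) = dum.
  apply/funext => z; rewrite /dum; congr (_ + expR _); by field.
move/is_derive_eq; apply; rewrite /GRing.scale/= /dum.
rewrite (_ : - (x ^+ 2 / 2) = - 2^-1 * x ^+ 2); last by field.
by field.
Qed.

Lemma continuous_um : continuous um.
Proof.
move=> x; apply: differentiable_continuous; apply/derivable1_diffP.
by have [] := is_derive_um x.
Qed.

Lemma continuous_dum : continuous dum.
Proof.
move=> x; apply: differentiable_continuous; apply/derivable1_diffP.
by have [] := is_derive_dum x.
Qed.

Lemma um_ge0 (x : R) : 0 <= um x.
Proof. by rewrite mulr_ge0 ?expR_ge0 ?gaussNy_ge0. Qed.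

Lemma um_le_pos (x : R) : um x <= gauss_mass * expR (x ^+ 2 / 2).
Proof. by rewrite /um mulrC ler_wpM2r ?expR_ge0 ?gaussNy_le. Qed.

Lemma um_le_neg (x : R) : x <= 0 -> (1 - x) * um x <= gaussC * expR (- (x ^+ 2 / 2)).
Proof.
move=> /gaussNy_bound H.
rewrite /um mulrCA (_ : - (x ^+ 2 / 2) = x ^+ 2 / 2 + - x ^+ 2); last by field.
by rewrite expRD [leRHS]mulrCA ler_wpM2l ?expR_ge0.
Qed.

Lemma dum_le_pos (x : R) : 0 <= x ->
  `|dum x| <= (gauss_mass + 1) * (1 + x) * expR (x ^+ 2 / 2).
Proof.
move=> x0; rewrite ger0_norm; last first.
  by apply: addr_ge0; [apply: mulr_ge0 => //; exact: um_ge0|exact: expR_ge0].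
have := um_le_pos x; have := um_ge0 x; have g0 := gauss_mass_gt0; rewrite /dum.
have : expR (- (x ^+ 2 / 2)) <= expR (x ^+ 2 / 2).
  by rewrite ler_expR; nra.
have : 0 <= expR (x ^+ 2 / 2) by exact: expR_ge0.
set E := expR (x ^+ 2 / 2); set E' := expR _; set u := um x.
move=> E0 EE u0 uE.
have : x * u <= x * (gauss_mass * E) by rewrite ler_wpM2l.
have : 0 <= gauss_mass * E by rewrite mulr_ge0// ltW.
by have := mulr_ge0 x0 E0; nra.
Qed.

Lemma dum_le_neg (x : R) : x <= 0 -> `|dum x| <= (gaussC + 1) * expR (- (x ^+ 2 / 2)).
Proof.
move=> x0; rewrite /dum (le_trans (ler_normD _ _))// mulrDl mul1r.
rewrite [X in _ + X]ger0_norm ?expR_ge0// lerD2r.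
rewrite normrM (ger0_norm (um_ge0 x)) (le_trans _ (um_le_neg x0))//.
by rewrite ler_wpM2r ?um_ge0// ler0_norm//; lra.
Qed.

Lemma expRN_sqr_le1 (x : R) : expR (- (x ^+ 2 / 2)) <= 1.
Proof. by rewrite -expR0 ler_expR oppr_le0 divr_ge0 ?sqr_ge0. Qed.

(** One constant above [gaussC + 1] and [gauss_mass + 1], so that the bounds for [um] and [dum] on
    both half-lines can be used in the same form. *)
Definition greenC : R := gaussC + 1 + gauss_mass.

(* The exponents in the three sign configurations all dominate
   (x - y) (1 + |x|) / 8 up to an additive constant. *)
Lemma green_bound_le (v : R -> R) (y x : R) :
  (forall x, x <= 0 -> `|v x| <= greenC * expR (- (x ^+ 2 / 2))) ->
  (forall x, 0 <= x -> `|v x| <= greenC * (1 + x) * expR (x ^+ 2 / 2)) ->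
  y <= x ->
  `|v y * um (- x)| <= greenC ^+ 2 * expR 1 * expR (- (8^-1 * (`|x - y| * (1 + `|x|)))).
Proof.
move=> vn vp yx; rewrite normrM (ger0_norm (um_ge0 _)) -mulrA -expRD.
have C2 := gaussC_ge2; have g0 := gauss_mass_gt0.
have CC : 0 < greenC by rewrite /greenC; lra.
have umn z : z <= 0 -> (1 - z) * um z <= greenC * expR (- (z ^+ 2 / 2)).
  move=> z0; apply: (le_trans (um_le_neg z0)).
  by rewrite ler_wpM2r ?expR_ge0// /greenC; lra.
have ump z : um z <= greenC * expR (z ^+ 2 / 2).
  apply: (le_trans (um_le_pos z)).
  by rewrite ler_wpM2r ?expR_ge0// /greenC; lra.
rewrite [`|x - y|]ger0_norm ?subr_ge0//.
suff [a [b [Ha Hb]]] : exists a b : R,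
    `|v y| * um (- x) <= greenC ^+ 2 * (expR a * expR b) /\
    a + b <= 1 - 8^-1 * ((x - y) * (1 + `|x|)).
  by apply: (le_trans Ha); rewrite -expRD ler_pM2l ?exprn_gt0// ler_expR; lra.
have [x0|x0] := lerP 0 x; last first.
  exists (- (y ^+ 2 / 2)), ((- x) ^+ 2 / 2); split => //.
    rewrite [greenC ^+ 2]expr2 [leRHS]mulrACA; apply: ler_pM => //; first exact: um_ge0.
    by apply: vn; lra.
  rewrite ltr0_norm//.
  have : 0 <= (x - y) * - x by rewrite mulr_ge0//; lra.
  by have := sqr_ge0 (x - y - 1); lra.
have xx : um (- x) * (1 + x) <= greenC * expR (- ((- x) ^+ 2 / 2)).
  by rewrite mulrC; have := umn (- x); rewrite opprK; apply; lra.
have [y0|y0] := lerP 0 y.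
  exists (y ^+ 2 / 2), (- ((- x) ^+ 2 / 2)); split => //; last first.
    rewrite ger0_norm// sqrrN.
    have : 0 <= (x - y) * y by rewrite mulr_ge0//; lra.
    by have := sqr_ge0 (x - y - 1); lra.
  (* The prefactor 1 + y of [v y] is at most 1 + x, which is paid for by the gain in [xx]. *)
  apply: (@le_trans _ _ (greenC * expR (y ^+ 2 / 2) * (um (- x) * (1 + x)))).
    apply: (@le_trans _ _ (greenC * (1 + y) * expR (y ^+ 2 / 2) * um (- x))).
      by rewrite ler_wpM2r ?um_ge0// vp.
    have := um_ge0 (- x); have := expR_ge0 (y ^+ 2 / 2).
    set E := expR _; set u := um _ => E0 u0.
    have : 0 <= greenC * E * u * (x - y).
      apply: mulr_ge0; last by rewrite subr_ge0.
      by apply: mulr_ge0 => //; apply: mulr_ge0 => //; exact: ltW.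
    by lra.
  rewrite [greenC ^+ 2]expr2 [leRHS]mulrACA ler_wpM2l//.
  by apply: mulr_ge0; [exact: ltW|exact: expR_ge0].
exists (- (y ^+ 2 / 2)), (- ((- x) ^+ 2 / 2)); split => //; last first.
  rewrite ger0_norm// sqrrN.
  have := sqr_ge0 (x - 1); have := sqr_ge0 (y + 1); have := sqr_ge0 (x + y).
  by have := sqr_ge0 x; have := sqr_ge0 y; lra.
rewrite [greenC ^+ 2]expr2 [leRHS]mulrACA; apply: ler_pM => //; first exact: um_ge0.
  by apply: vn; lra.
by apply: le_trans xx; rewrite ler_peMr ?um_ge0//; lra.
Qed.

(* The Green kernel for v = um, s = 1, and its y-derivative for v = dum,
   s = -1, because the derivative of u (- y) is - dum (- y). *)
Definition green (v : R -> R) (s y x : R) : R :=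
  (if y < x then v y * um (- x) else s * (v (- y) * um x)) / gauss_mass.

(** The factor 1 + |x| reflects the local rate of the solutions of u'' = (x^2 + 1) u: integration in
    y then yields a bound of order 1 / (1 + |x|), which is square integrable. *)
Definition green_decay (H : R -> R -> R) : Prop := exists2 C : R, 0 <= C &
  forall y x, `|H y x| <= C * expR (- (8^-1 * (`|x - y| * (1 + `|x|)))).

Lemma green_decayP (v : R -> R) (s : R) : `|s| = 1 ->
  (forall x, x <= 0 -> `|v x| <= greenC * expR (- (x ^+ 2 / 2))) ->
  (forall x, 0 <= x -> `|v x| <= greenC * (1 + x) * expR (x ^+ 2 / 2)) ->
  green_decay (green v s).
Proof.
move=> s1 vn vp; have g0 := gauss_mass_gt0.
exists (greenC ^+ 2 * expR 1 / gauss_mass).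
  by rewrite mulr_ge0 ?invr_ge0 ?(ltW g0)// mulr_ge0 ?expR_ge0 ?sqr_ge0.
move=> y x; rewrite /green normrM [`|gauss_mass^-1|]gtr0_norm ?invr_gt0//.
rewrite [leRHS]mulrAC ler_wpM2r ?invr_ge0 ?(ltW g0)//.
case: ltP => [/ltW|] xy; first exact: green_bound_le.
(* The side x <= y is the other one seen in the mirror: apply the bound at (- y, - x). *)
rewrite normrM s1 mul1r -{1}[x]opprK.
have := @green_bound_le v (- y) (- x) vn vp; rewrite lerN2 => /(_ xy).
by rewrite -opprD !normrN.
Qed.

Lemma green_um_decay : green_decay (green um 1).
Proof.
have C2 := gaussC_ge2; have g0 := gauss_mass_gt0.
apply: green_decayP => [|x x0|x x0]; first by rewrite normr1.
  rewrite ger0_norm ?um_ge0// (@le_trans _ _ ((1 - x) * um x))//.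
    by rewrite ler_peMl ?um_ge0//; lra.
  by rewrite (le_trans (um_le_neg x0))// ler_wpM2r ?expR_ge0// /greenC; lra.
rewrite ger0_norm ?um_ge0// (le_trans (um_le_pos x))// ler_wpM2r ?expR_ge0//.
by rewrite /greenC; nra.
Qed.

Lemma green_dum_decay : green_decay (green dum (- 1)).
Proof.
have C2 := gaussC_ge2; have g0 := gauss_mass_gt0.
apply: green_decayP => [|x x0|x x0]; first by rewrite normrN1.
  by rewrite (le_trans (dum_le_neg x0))// ler_wpM2r ?expR_ge0// /greenC; lra.
rewrite (le_trans (dum_le_pos x0))// ler_wpM2r ?expR_ge0// ler_wpM2r//; first by lra.
by rewrite /greenC; lra.
Qed.

Lemma integrable_osc_half (phi u : R -> R) (D : set (measurableTypeR R)) (B : R) : schwartz phi ->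
  measurable D -> continuous u -> (forall x, D x -> `|u x| <= B) ->
  leb.-integrable D (EFin \o (fun x => u x * osc phi x)).
Proof.
move=> sphi mD cu uB.
have i : leb.-integrable D (EFin \o osc phi).
  exact: (integrableS _ _ _ (integrable_osc sphi)).
apply: (le_integrableR mD _ _ (integrable_norm (integrableZlR B mD i))).
  apply: measurable_funM; apply: measurable_funTS.
    exact: continuous_measurable_fun.
  by apply: continuous_measurable_fun; exact: continuous_osc.
move=> x Dx; rewrite /= normrM [leRHS]normrM ler_wpM2r//.
by rewrite (le_trans (uB x Dx))// ler_norm.
Qed.

Lemma um_bounded (y x : R) : x <= y -> `|um x| <= gaussC + gauss_mass * expR (y ^+ 2 / 2).
Proof.
have C2 := gaussC_ge2; have g0 := gauss_mass_gt0.
move=> xy; rewrite ger0_norm ?um_ge0//.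
have m0 : 0 <= gauss_mass * expR (y ^+ 2 / 2) by rewrite mulr_ge0 ?expR_ge0// ltW.
have [x0|x0] := lerP x 0.
  have e1 := expRN_sqr_le1 x.
  have := um_le_neg x0; have := um_ge0 x; nra.
rewrite (le_trans (um_le_pos x))// ler_wpDl//; first by lra.
by rewrite ler_pM2l// ler_expR; nra.
Qed.

(** Lagrange identity: since A u = 0, the product u A phi is the derivative of - u phi' + u' phi,
    which vanishes at -oo. *)
Lemma integral_um_osc (phi : R -> R) (y : R) : schwartz phi ->
  \int[leb]_(x in `]-oo, y]) (um x * osc phi x) =
  - (um y * derive1 phi y) + dum y * phi y.
Proof.
move=> sphi; have C2 := gaussC_ge2; have g0 := gauss_mass_gt0.
pose Q x := - (um x * derive1 phi x) + dum x * phi x.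
have dQ x : is_derive x (1 : R) Q (um x * osc phi x).
  have d1 := is_derive_um x; have d2 := is_derive_dum x.
  have d3 := schwartz_is_derive x sphi.
  have d4 := schwartz_is_derive x (schwartz_derive1 sphi).
  have := is_deriveD (is_deriveN (is_deriveM d1 d4)) (is_deriveM d2 d3).
  by move/is_derive_eq; apply; rewrite /GRing.scale/= /osc derive1nS derive1n1; ring.
have cg : continuous (fun x => um x * osc phi x).
  by move=> x; apply: cvgM; [exact: continuous_um|exact: continuous_osc].
have ig : leb.-integrable `]-oo, y] (EFin \o (fun x => um x * osc phi x)).
  apply: (integrable_osc_half sphi (measurable_itv _) continuous_um) => x.
  by rewrite /= in_itv/=; exact: um_bounded.
apply: (Rintegral_itvNyc_derive dQ cg ig).
have [M0 p0 H0] := schwartz_decay 0 sphi.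
have [M1 p1 H1] := schwartz_decay 0 (schwartz_derive1 sphi).
apply: (@decay_cvg0 _ _ (gaussC * M1 + (gaussC + 1) * M0) (fun n => - n%:R)) => n.
  by rewrite normrN normr_nat.
set x := - n%:R; have x0 : x <= 0 by rewrite oppr_le0.
have e1 := expRN_sqr_le1 x.
have e0 : 0 <= expR (- (x ^+ 2 / 2)) by exact: expR_ge0.
rewrite /Q (le_trans (ler_normD _ _))// [leRHS]mulrDl lerD// ?normrN normrM -mulrA ler_pM//.
- rewrite ger0_norm ?um_ge0//; have := um_le_neg x0; have := um_ge0 x; nra.
- by have := H1 x; rewrite expr0 mul1r.
- by rewrite (le_trans (dum_le_neg x0))// ler_piMr//; lra.
- by have := H0 x; rewrite expr0 mul1r.
Qed.

Lemma integral_umN_osc (phi : R -> R) (y : R) : schwartz phi ->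
  \int[leb]_(x in `]y, +oo[) (um (- x) * osc phi x) =
  um (- y) * derive1 phi y + dum (- y) * phi y.
Proof.
move=> sphi; have C2 := gaussC_ge2; have g0 := gauss_mass_gt0.
pose Q x := - (um (- x) * derive1 phi x) - dum (- x) * phi x.
have dN x : is_derive x (1 : R) (fun x : R => - x) (-1) by apply: is_deriveN.
have cuN : continuous (fun x => um (- x)).
  move=> x; apply: (@continuous_comp _ _ _ (fun x : R => - x)); last exact: continuous_um.
  exact: opp_continuous.
have dQ x : is_derive x (1 : R) Q (um (- x) * osc phi x).
  have d1 := is_derive1_comp (is_derive_um (- x)) (dN x).
  have d2 := is_derive1_comp (is_derive_dum (- x)) (dN x).
  have d3 := schwartz_is_derive x sphi.
  have d4 := schwartz_is_derive x (schwartz_derive1 sphi).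
  have := is_deriveB (is_deriveN (is_deriveM d1 d4)) (is_deriveM d2 d3).
  by move/is_derive_eq; apply; rewrite /GRing.scale/= /osc derive1nS derive1n1; ring.
have cg : continuous (fun x => um (- x) * osc phi x).
  by move=> x; apply: cvgM; [exact: cuN|exact: continuous_osc].
have ig : leb.-integrable `]y, +oo[ (EFin \o (fun x => um (- x) * osc phi x)).
  apply: (@integrable_osc_half _ (fun x => um (- x)) _ _ sphi (measurable_itv _) cuN) => x.
  rewrite /= in_itv/= andbT => xy; apply: (@um_bounded (- y)).
  by rewrite lerN2 ltW.
rewrite (Rintegral_itvoy_derive dQ cg ig); first by rewrite /Q; ring.
have [M0 p0 H0] := schwartz_decay 0 sphi.
have [M1 p1 H1] := schwartz_decay 0 (schwartz_derive1 sphi).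
apply: (@decay_cvg0 _ _ (gaussC * M1 + (gaussC + 1) * M0) (fun n => n%:R)) => n.
  by rewrite normr_nat.
set x := n%:R; have x0 : - x <= 0 by rewrite oppr_le0.
have e1 := expRN_sqr_le1 (- x).
have e0 : 0 <= expR (- ((- x) ^+ 2 / 2)) by exact: expR_ge0.
rewrite /Q (le_trans (ler_normB _ _))// [leRHS]mulrDl lerD// ?normrN normrM -mulrA ler_pM//.
- rewrite ger0_norm ?um_ge0//; have := um_le_neg x0; have := um_ge0 (- x); nra.
- by have := H1 x; rewrite expr0 mul1r.
- by rewrite (le_trans (dum_le_neg x0))// ler_piMr//; lra.
- by have := H0 x; rewrite expr0 mul1r.
Qed.

(** The terms in [um y * um (- y)] cancel, and the exponential prefactors of the rest multiply to 1,
    leaving the two complementary Gaussian integrals. *)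
Lemma wronskian (y : R) : um y * dum (- y) + um (- y) * dum y = gauss_mass.
Proof.
rewrite -(gaussNyD y) /dum sqrrN.
have -> : um y * (- y * um (- y) + expR (- (y ^+ 2 / 2))) +
  um (- y) * (y * um y + expR (- (y ^+ 2 / 2))) =
  (um y + um (- y)) * expR (- (y ^+ 2 / 2)) by ring.
rewrite /um sqrrN -mulrDr mulrAC -expRD subrr expR0 mul1r //.
Qed.

(** Kept general in [v] and [s] to serve two representations. For [um] and 1 the terms in phi'
    cancel, for [dum] and -1 those in phi; what remains is the Wronskian times phi or phi'. *)
Lemma integral_green (v phi : R -> R) (s y : R) : schwartz phi ->
  \int[leb]_x (green v s y x * osc phi x) =
  (v y * (um (- y) * derive1 phi y + dum (- y) * phi y) +
   s * v (- y) * (- (um y * derive1 phi y) + dum y * phi y)) / gauss_mass.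
Proof.
move=> sphi; rewrite -(integral_umN_osc y sphi) -(integral_um_osc y sphi).
have cuN : continuous (fun x => um (- x)).
  move=> x; apply: (@continuous_comp _ _ _ (fun x : R => - x)); last exact: continuous_um.
  exact: opp_continuous.
have ig2 : leb.-integrable `]-oo, y] (EFin \o (fun x => um x * osc phi x)).
  apply: (integrable_osc_half sphi (measurable_itv _) continuous_um) => x.
  by rewrite /= in_itv/=; exact: um_bounded.
have ig1 : leb.-integrable `]y, +oo[ (EFin \o (fun x => um (- x) * osc phi x)).
  apply: (@integrable_osc_half _ (fun x => um (- x)) _ _ sphi (measurable_itv _) cuN) => x.
  rewrite /= in_itv/= andbT => xy; apply: (@um_bounded (- y)).
  by rewrite lerN2 ltW.
have p1 := (integrable_patch _ (measurable_itv _)).1 ig1.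
have p2 := (integrable_patch _ (measurable_itv _)).1 ig2.
rewrite [in RHS]Rintegral_mkcond [in X in _ + X]Rintegral_mkcond.
rewrite -RintegralZl// -RintegralZl// -RintegralD//; last 2 first.
  exact: integrableZlR.
  exact: integrableZlR.
rewrite -RintegralZr//; last by apply: integrableDR => //; exact: integrableZlR.
apply: eq_Rintegral => x _; rewrite /green !patchE !mem_setE !in_itv/= andbT.
by rewrite -[point]/(0 : R); case: ltP => _; field; rewrite gt_eqF ?gauss_mass_gt0.
Qed.

Lemma green_um_repr (phi : R -> R) (y : R) : schwartz phi ->
  \int[leb]_x (green um 1 y x * osc phi x) = phi y.
Proof.
move=> sphi; rewrite integral_green//.
rewrite [X in X / _](_ : _ = phi y * (um y * dum (- y) + um (- y) * dum y)); last by ring.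
by rewrite wronskian mulfK// gt_eqF// gauss_mass_gt0.
Qed.

Lemma green_dum_repr (phi : R -> R) (y : R) : schwartz phi ->
  \int[leb]_x (green dum (- 1) y x * osc phi x) = derive1 phi y.
Proof.
move=> sphi; rewrite integral_green//.
rewrite [X in X / _](_ : _ = derive1 phi y * (um y * dum (- y) + um (- y) * dum y)); last by ring.
by rewrite wronskian mulfK// gt_eqF// gauss_mass_gt0.
Qed.

Lemma measurable_green (v : R -> R) (s : R) : continuous v ->
  measurable_fun [set: (measurableTypeR R * measurableTypeR R)%type]
    (fun z => green v s z.1 z.2).
Proof.
move=> cv; have mv : measurable_fun setT v by exact: continuous_measurable_fun.
have mu : measurable_fun setT um by apply: continuous_measurable_fun; exact: continuous_um.
apply: measurable_funM => //; apply: measurable_fun_ifT.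
- exact: measurable_fun_ltr.
- apply: measurable_funM; first exact: measurableT_comp.
  by apply: (measurableT_comp mu); exact: measurableT_comp.
- apply: measurable_funM => //; apply: measurable_funM; last exact: measurableT_comp.
  by apply: (measurableT_comp mv); exact: measurableT_comp.
Qed.

End GreenKernel.

(** * Integral operators with the decay of the Green kernel *)

Section KernelOperator.
Context {R : realType}.
Local Notation leb := (@lebesgue_measure R).
Local Notation RR := (measurableTypeR R * measurableTypeR R)%type.

(** Tonelli makes the integrals of the positive and negative parts measurable in x; [fine] of their
    difference is the real integral at every x, including where it diverges. *)
Lemma measurable_partial_Rintegral (f : RR -> R) : measurable_fun setT f ->
  measurable_fun setT (fun x : R => \int[leb]_y f (y, x)).
Proof.
move=> mf; have mf' : measurable_fun setT (EFin \o f) by exact/measurable_EFinP.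
have -> : (fun x : R => \int[leb]_y f (y, x)) =
  fine \o (fun x => \int[leb]_y ((EFin \o f)^\+ (y, x)) - \int[leb]_y ((EFin \o f)^\- (y, x)))%E.
  apply/funext => x /=; rewrite /Rintegral integralE; congr (fine (_ - _)).
    by apply: eq_integral => y _; rewrite !funeposE.
  by apply: eq_integral => y _; rewrite !funenegE.
apply: measurableT_comp; first exact: fine_measurable.
apply: emeasurable_funB.
  apply: (@measurable_fun_fubini_tonelli_G _ _ _ _ R leb (EFin \o f)^\+%E).
    exact: measurable_funepos.
  exact: funepos_ge0.
apply: (@measurable_fun_fubini_tonelli_G _ _ _ _ R leb (EFin \o f)^\-%E).
  exact: measurable_funeneg.
exact: funeneg_ge0.
Qed.

(* psi lies in L^1 + L^oo, with the explicit bound psi1 + M. *)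
Definition tame (psi : R -> R) (psi1 : R -> R) (M : R) : Prop :=
  [/\ measurable_fun setT psi, leb.-integrable setT (EFin \o psi1), 0 <= M
    & forall x, `|psi x| <= psi1 x + M].

Variables (H : R -> R -> R) (C : R).
Hypothesis mH : measurable_fun [set: RR] (fun z => H z.1 z.2).
Hypothesis C0 : 0 <= C.
Hypothesis HC : forall y x, `|H y x| <= C * expR (- (8^-1 * (`|x - y| * (1 + `|x|)))).

Definition kernel_op (psi : R -> R) (x : R) : R := \int[leb]_y (psi y * H y x).

Lemma kernel_le_exp y x : `|H y x| <= C * expR (- (8^-1 * `|x - y|)).
Proof.
apply: le_trans (HC y x) _; rewrite ler_wpM2l// ler_expR lerN2 ler_pM2l//.
by rewrite ler_peMr// lerDl.
Qed.

Lemma kernel_le y x : `|H y x| <= C.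
Proof.
apply: le_trans (kernel_le_exp y x) _.
by rewrite ler_piMr// -[leRHS]expR0 ler_expR oppr_le0 mulr_ge0.
Qed.

Lemma measurable_kernel1 x : measurable_fun setT (fun y => H y x).
Proof. exact: (measurable_fun_pair1 x mH). Qed.

Lemma measurable_kernel2 y : measurable_fun setT (H y).
Proof. exact: (measurable_fun_pair2 y mH). Qed.

Lemma measurable_exp_norm (a y : R) :
  measurable_fun setT (fun x : R => (expR (- (a * `|x - y|)))%:E).
Proof.
apply/measurable_EFinP; apply: measurableT_comp => //; apply: measurableT_comp => //.
apply: measurable_funM => //; apply: measurableT_comp => //; exact: measurable_funB.
Qed.

(** Here 1 + |x| is bounded below by 1, since x is the variable of integration; 16 is 2 / (1/8). *)
Lemma kernel_int_out y : (\int[leb]_x `|H y x|%:E <= (16 * C)%:E)%E.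
Proof.
apply: (@le_trans _ _ (\int[leb]_x (C%:E * (expR (- (8^-1 * `|x - y|)))%:E))%E).
  apply: ge0_le_integral => //.
  - by apply/measurable_EFinP; apply: measurableT_comp => //; exact: measurable_kernel2.
  - by apply: measurable_funeM; exact: measurable_exp_norm.
  - by move=> x _; rewrite -EFinM lee_fin kernel_le_exp.
rewrite ge0_integralZl//; last exact: measurable_exp_norm.
rewrite ge0_integral_expR_norm// -EFinM lee_fin.
by rewrite invrK mulrC; lra.
Qed.

(** With x fixed the whole rate (1 + |x|) / 8 is available, which produces the decay in x. *)
Lemma kernel_int_in x : (\int[leb]_y `|H y x|%:E <= (16 * C / (1 + `|x|))%:E)%E.
Proof.
have x0 : 0 < 8^-1 * (1 + `|x|) by rewrite mulr_gt0// ltr_pwDl.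
apply: (@le_trans _ _ (\int[leb]_y (C%:E * (expR (- ((8^-1 * (1 + `|x|)) * `|y - x|)))%:E))%E).
  apply: ge0_le_integral => //.
  - by apply/measurable_EFinP; apply: measurableT_comp => //; exact: measurable_kernel1.
  - by apply: measurable_funeM; exact: measurable_exp_norm.
  - move=> y _; rewrite -EFinM lee_fin.
    by rewrite (le_trans (HC y x))// distrC mulrAC mulrA.
rewrite ge0_integralZl//; last exact: measurable_exp_norm.
rewrite ge0_integral_expR_norm// -EFinM lee_fin le_eqVlt; apply/orP; left; apply/eqP.
by field; rewrite gt_eqF// ltr_pwDl.
Qed.

Section Tame.
Variables (psi psi1 : R -> R) (M : R).
Hypothesis tpsi : tame psi psi1 M.

Let mpsi : measurable_fun setT psi. Proof. by have [] := tpsi. Qed.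
Let ipsi1 : leb.-integrable setT (EFin \o psi1). Proof. by have [] := tpsi. Qed.
Let mpsi1 : measurable_fun setT psi1.
Proof. by have /integrableP[/measurable_EFinP] := ipsi1. Qed.
Let M0 : 0 <= M. Proof. by have [] := tpsi. Qed.
Let I := \int[leb]_y `|psi1 y|.

Let IE : (\int[leb]_y `|psi1 y|%:E)%E = I%:E.
Proof. by rewrite fineK//; apply: integrable_fin_num => //; exact: (integrable_norm ipsi1). Qed.

Let I0 : 0 <= I. Proof. by apply: Rintegral_ge0. Qed.

(** The share of the L^1 part of psi. Both its supremum and its integral are estimated, since its
    square is bounded by their product. *)
Let A x : \bar R := (\int[leb]_y (`|psi1 y| * `|H y x|)%:E)%E.

Let mA : measurable_fun setT A.
Proof.
apply: (@measurable_fun_fubini_tonelli_G _ _ _ _ R leb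
  (fun z : RR => (`|psi1 z.1| * `|H z.1 z.2|)%:E)).
  apply/measurable_EFinP; apply: measurable_funM; apply: measurableT_comp => //.
  exact: measurableT_comp.
by move=> z; rewrite lee_fin mulr_ge0.
Qed.

Let A_le x : (A x <= (C * I)%:E)%E.
Proof.
rewrite EFinM -IE -ge0_integralZl//; last first.
  by apply/measurable_EFinP; exact: measurableT_comp.
apply: ge0_le_integral => //.
- apply/measurable_EFinP; apply: measurable_funM; apply: measurableT_comp => //.
  exact: measurable_kernel1.
- by apply: measurable_funeM; apply/measurable_EFinP; exact: measurableT_comp.
- by move=> y _; rewrite -EFinM lee_fin mulrC ler_wpM2r// kernel_le.
Qed.

Let A_ge0 x : (0 <= A x)%E.
Proof. by apply: integral_ge0 => y _; rewrite lee_fin mulr_ge0. Qed.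

Let int_A : (\int[leb]_x A x <= (16 * C * I)%:E)%E.
Proof.
rewrite /A -(@fubini_tonelli _ _ _ _ R leb leb
  (fun z : RR => (`|psi1 z.1| * `|H z.1 z.2|)%:E)); last 2 first.
- apply/measurable_EFinP; apply: measurable_funM; apply: measurableT_comp => //.
  exact: measurableT_comp.
- by move=> z; rewrite lee_fin mulr_ge0.
rewrite EFinM -IE -ge0_integralZl//; last 2 first.
- by apply/measurable_EFinP; exact: measurableT_comp.
- by rewrite lee_fin mulr_ge0.
apply: ge0_le_integral => //.
- by move=> y _; apply: integral_ge0 => x _; rewrite lee_fin mulr_ge0.
- apply: (@measurable_fun_fubini_tonelli_F _ _ _ _ R leb
    (fun z : RR => (`|psi1 z.1| * `|H z.1 z.2|)%:E)).
    apply/measurable_EFinP; apply: measurable_funM; apply: measurableT_comp => //.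
    exact: measurableT_comp.
  by move=> z; rewrite lee_fin mulr_ge0.
- by apply: measurable_funeM; apply/measurable_EFinP; exact: measurableT_comp.
- move=> y _ /=.
  under eq_integral do rewrite EFinM.
  rewrite ge0_integralZl//; last first.
    by apply/measurable_EFinP; apply: measurableT_comp => //; exact: measurable_kernel2.
  by rewrite muleC lee_wpmul2r// kernel_int_out.
Qed.

Lemma kernel_op_abs x :
  (\int[leb]_y `|psi y * H y x|%:E <= A x + (16 * M * C / (1 + `|x|))%:E)%E.
Proof.
apply: (@le_trans _ _ (\int[leb]_y ((`|psi1 y| * `|H y x|)%:E + M%:E * `|H y x|%:E))%E).
  apply: ge0_le_integral => //.
  - apply/measurable_EFinP; apply: measurableT_comp => //; apply: measurable_funM => //.
    exact: measurable_kernel1.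
  - apply: emeasurable_funD.
      apply/measurable_EFinP; apply: measurable_funM; apply: measurableT_comp => //.
      exact: measurable_kernel1.
    apply: measurable_funeM; apply/measurable_EFinP; apply: measurableT_comp => //.
    exact: measurable_kernel1.
  - move=> y _; rewrite -EFinM -EFinD lee_fin normrM -mulrDl ler_wpM2r//.
    by have [_ _ _ /(_ y)/le_trans] := tpsi; apply; rewrite lerD2r ler_norm.
rewrite ge0_integralD//; last 3 first.
- apply/measurable_EFinP; apply: measurable_funM; apply: measurableT_comp => //.
  exact: measurable_kernel1.
- by move=> y _; rewrite mule_ge0.
- apply: measurable_funeM; apply/measurable_EFinP; apply: measurableT_comp => //.
  exact: measurable_kernel1.
rewrite leeD2l// ge0_integralZl//; last first.
  by apply/measurable_EFinP; apply: measurableT_comp => //; exact: measurable_kernel1.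
have -> : 16 * M * C / (1 + `|x|) = M * (16 * C / (1 + `|x|)) by ring.
by rewrite [leRHS]EFinM lee_wpmul2l// ?lee_fin// kernel_int_in.
Qed.

Lemma kernel_op_abs_le x :
  (\int[leb]_y `|psi y * H y x|%:E <= (C * I + 16 * M * C)%:E)%E.
Proof.
apply: le_trans (kernel_op_abs x) _; rewrite [leRHS]EFinD leeD// lee_fin.
rewrite ler_piMr ?mulr_ge0// invf_le1 ?ltr_pwDl//.
by rewrite lerDl.
Qed.

Lemma kernel_op_integrable x : leb.-integrable setT (EFin \o (fun y => psi y * H y x)).
Proof.
apply/integrableP; split.
  by apply/measurable_EFinP; apply: measurable_funM => //; exact: measurable_kernel1.
exact: le_lt_trans (kernel_op_abs_le x) (ltry _).
Qed.

Lemma measurable_kernel_op : measurable_fun setT (kernel_op psi).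
Proof.
apply: (@measurable_partial_Rintegral (fun z => psi z.1 * H z.1 z.2)).
by apply: measurable_funM => //; exact: measurableT_comp.
Qed.

(** Pointwise |G| <= A + c with c = 16 M C / (1 + |x|), hence G^2 <= 2 A^2 + 2 c^2. Bounding one
    factor A by C I and integrating the other, at most 16 C I, gives 32 (C I)^2; the last term uses
    (1 + |x|)^2 >= 1 + x^2. *)
Lemma kernel_op_L2 :
  (\int[leb]_x ((kernel_op psi x) ^+ 2)%:E <= (32 * (C * I) ^+ 2)%:E +
     (2 * (16 * M * C) ^+ 2)%:E * \int[leb]_x ((1 + x ^+ 2)^-1)%:E)%E.
Proof.
have mV : measurable_fun setT (fun x : R => ((1 + x ^+ 2)^-1)%:E).
  by apply/measurable_EFinP; apply: continuous_measurable_fun; exact: continuous_oneDsqrV.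
have V0 (x : R) : 0 <= (1 + x ^+ 2)^-1 by rewrite invr_ge0 addr_ge0 ?sqr_ge0.
have sq (x : R) : ((kernel_op psi x ^+ 2)%:E <= (2 * (C * I))%:E * A x +
    (2 * (16 * M * C) ^+ 2)%:E * ((1 + x ^+ 2)^-1)%:E)%E.
  have := A_le x; have := A_ge0 x; have := kernel_op_abs x.
  have := le_normr_Rintegral measurableT (kernel_op_integrable x).
  rewrite -lee_fin fineK; last first.
    by apply: integrable_fin_num => //; exact: (integrable_norm (kernel_op_integrable x)).
  case: (A x) => [a| |]; last 2 first.
  - by move=> _ _ _; rewrite leye_eq.
  - by move=> _ _; rewrite leeNy_eq.
  move=> h1 h2; have {h1 h2} := le_trans h1 h2.
  rewrite -EFinD -!EFinM -EFinD !lee_fin -/(kernel_op psi x).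
  set u := kernel_op psi x; set b := 16 * M * C => ub a0 aC.
  have b0 : 0 <= b by rewrite !mulr_ge0.
  have x0 : 0 < 1 + `|x| by rewrite ltr_pwDl.
  set c := b / (1 + `|x|); have c0 : 0 <= c by rewrite divr_ge0// ltW.
  have cb : c ^+ 2 <= b ^+ 2 * (1 + x ^+ 2)^-1.
    rewrite /c exprMn ler_wpM2l ?sqr_ge0// exprVn lef_pV2 ?posrE ?exprn_gt0//; last first.
      by rewrite ltr_pwDl ?sqr_ge0.
    rewrite -(real_normK (num_real x)); have := normr_ge0 x; nra.
  have u2 : u ^+ 2 <= (a + c) ^+ 2.
    by rewrite -(real_normK (num_real u)) lerXn2r// ?nnegrE ?addr_ge0.
  have : a * a <= a * (C * I) by rewrite ler_wpM2l.
  have := sqr_ge0 (a - c); nra.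
apply: (@le_trans _ _ (\int[leb]_x ((2 * (C * I))%:E * A x +
    (2 * (16 * M * C) ^+ 2)%:E * ((1 + x ^+ 2)^-1)%:E))%E).
  apply: ge0_le_integral => //.
  - by move=> x _; rewrite lee_fin sqr_ge0.
  - by apply/measurable_EFinP; apply: measurable_funX; exact: measurable_kernel_op.
  - by apply: emeasurable_funD; apply: measurable_funeM.
rewrite ge0_integralD//; last 4 first.
- by move=> x _; rewrite mule_ge0// lee_fin !mulr_ge0.
- exact: measurable_funeM.
- by move=> x _; rewrite mule_ge0// lee_fin// mulr_ge0// sqr_ge0.
- exact: measurable_funeM.
rewrite ge0_integralZl//; last by rewrite lee_fin !mulr_ge0.
rewrite ge0_integralZl//; last 2 first.
- by move=> x _; rewrite lee_fin.
- by rewrite lee_fin mulr_ge0// sqr_ge0.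
rewrite leeD2r//.
have -> : 32 * (C * I) ^+ 2 = 2 * (C * I) * (16 * C * I) by ring.
by rewrite [leRHS]EFinM lee_wpmul2l// lee_fin !mulr_ge0.
Qed.

(** Transfers the kernel from the test function side to psi. The product integrand is integrable
    because the y-integral of |psi H| is bounded uniformly in x and g is integrable. *)
Lemma kernel_op_fubini (g : R -> R) : leb.-integrable setT (EFin \o g) ->
  \int[leb]_y (psi y * \int[leb]_x (H y x * g x)) =
  \int[leb]_x (kernel_op psi x * g x).
Proof.
move=> ig; have mg : measurable_fun setT g by have /integrableP[/measurable_EFinP] := ig.
pose f (z : RR) := (psi z.1 * H z.1 z.2 * g z.2)%:E.
have mf : measurable_fun setT f.
  apply/measurable_EFinP; apply: measurable_funM; last exact: measurableT_comp.
  by apply: measurable_funM => //; exact: measurableT_comp.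
have fi : (leb \x leb)%E.-integrable setT f.
  apply/integrable21ltyP => //.
  apply: (@le_lt_trans _ _ (\int[leb]_x ((C * I + 16 * M * C)%:E * `|g x|%:E))%E).
    apply: ge0_le_integral => //.
    - by move=> x _; exact: integral_ge0.
    - apply: (@measurable_fun_fubini_tonelli_G _ _ _ _ R leb (fun z => `|f z|%E)) => //.
      exact: measurableT_comp.
    - by apply: measurable_funeM; apply/measurable_EFinP; exact: measurableT_comp.
    - move=> x _; rewrite /f.
      under eq_integral do rewrite /= normrM EFinM.
      rewrite ge0_integralZr//; last first.
        apply/measurable_EFinP; apply: measurableT_comp => //; apply: measurable_funM => //.
        exact: measurable_kernel1.
      by rewrite lee_wpmul2r// kernel_op_abs_le.
  rewrite ge0_integralZl//; last 2 first.
    by apply/measurable_EFinP; exact: measurableT_comp.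
    by rewrite lee_fin addr_ge0 ?mulr_ge0.
  rewrite lte_mul_pinfty ?lee_fin ?addr_ge0 ?mulr_ge0//.
  by have /integrableP[] := ig.
have := Fubini fi => E.
rewrite /Rintegral; congr fine.
transitivity (\int[leb]_y \int[leb]_x f (y, x))%E.
  apply: eq_integral => y _; rewrite /f/=.
  have iHg : leb.-integrable setT (EFin \o (fun x => H y x * g x)).
    apply: (le_integrableR measurableT _ _ (integrableZlR C measurableT (integrable_norm ig))).
      by apply: measurable_funM => //; exact: measurable_kernel2.
    by move=> x _; rewrite normrM ler_wpM2r// kernel_le.
  under [RHS]eq_integral do rewrite -mulrA EFinM.
  rewrite integralZl// EFinM; congr (_ * _)%E.
  by rewrite fineK//; exact: integrable_fin_num.
rewrite E; apply: eq_integral => x _; rewrite /f/=.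
under [LHS]eq_integral do rewrite EFinM.
rewrite integralZr//; last exact: kernel_op_integrable.
rewrite EFinM; congr (_ * _)%E.
by rewrite fineK//; apply: integrable_fin_num => //; exact: kernel_op_integrable.
Qed.

End Tame.
End KernelOperator.

(** * Translations and integrals over intervals *)

Section Shift.
Context {R : realType}.
Local Notation leb := (@lebesgue_measure R).

Lemma Rintegral_shift (c : R) (f : R -> R) : measurable_fun setT f ->
  \int[leb]_x f (x + c) = \int[leb]_x f x.
Proof.
move=> mf; rewrite -(Rintegral_reflect c mf).
rewrite -(@Rintegral_reflect _ 0 (fun x => f (c - x))); last first.
  exact: (measurableT_comp mf (measurable_reflect_at c)).
by apply: eq_Rintegral => x _; congr f; ring.
Qed.

Lemma integrable_shift (c : R) (f : R -> R) :
  leb.-integrable setT (EFin \o f) ->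
  leb.-integrable setT (EFin \o (fun x => f (x + c))).
Proof.
move=> /(integrable_reflect c)/(integrable_reflect 0).
by apply: eq_integrable => // x _ /=; congr (f _)%:E; ring.
Qed.

Lemma ge0_subset_Rintegral (A B : set (measurableTypeR R)) (f : R -> R) :
  measurable A -> measurable B -> leb.-integrable B (EFin \o f) ->
  (forall x, B x -> 0 <= f x) -> A `<=` B ->
  \int[leb]_(x in A) f x <= \int[leb]_(x in B) f x.
Proof.
move=> mA mB iB f0 AB.
have iA : leb.-integrable A (EFin \o f) by exact: integrableS iB.
apply: fine_le; [exact: integrable_fin_num|exact: integrable_fin_num|].
apply: ge0_subset_integral => //.
by have /integrableP[] := iB.
Qed.

Lemma fine_lebesgue_itvcc (a b : R) : a <= b -> fine (leb `[a, b]%classic) = b - a.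
Proof.
move=> ab; rewrite lebesgue_measure_itv/= lte_fin; case: ltgtP ab => [//||->] _ //=.
by rewrite subrr.
Qed.

End Shift.

(** * Nonincreasing convolution kernels *)

Section DecreasingKernel.
Context {R : realType}.
Local Notation leb := (@lebesgue_measure R).
Local Notation RR := (measurableTypeR R * measurableTypeR R)%type.

(** Monotonicity is imposed on positive arguments only: [k] may blow up at 0 from the right and is 0
    at 0 itself. Vanishing on the left turns one-sided convolutions into integrals over the whole
    line. *)
Record decreasing_kernel (k : R -> R) : Prop := DecreasingKernel {
  dk_le0 : forall x, x <= 0 -> k x = 0;
  dk_ge0 : forall x, 0 <= k x;
  dk_dec : forall x y, 0 < x -> x <= y -> k y <= k x;
  dk_meas : measurable_fun setT k;
  dk_int : forall e, leb.-integrable `[0, e] (EFin \o k) }.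

Variable k : R -> R.
Hypothesis dk : decreasing_kernel k.

Definition kmass (d : R) : R := \int[leb]_(x in `[0, d]) k x.

Lemma kmass_cvg0 : kmass d @[d --> 0] --> (0 : R).
Proof. exact: (parameterized_integral_cvg_left ltr01 (dk_int dk 1)). Qed.

Lemma kmass_ge0 d : 0 <= kmass d.
Proof. by apply: Rintegral_ge0 => x _; exact: dk_ge0. Qed.

Lemma le_kmass d e : d <= e -> kmass d <= kmass e.
Proof.
move=> de; apply: ge0_subset_Rintegral => //; first exact: dk_int.
- by move=> x _; exact: dk_ge0.
- by apply: subset_itvl; rewrite bnd_simp.
Qed.

Lemma kmassE d : kmass d = \int[leb]_x (k \_ `[0, d]) x.
Proof. by rewrite /kmass Rintegral_mkcond. Qed.

Lemma kmass_oc d : kmass d = \int[leb]_(x in `]0, d]) k x.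
Proof.
rewrite Rintegral_itv_obnd_cbnd//.
by apply: integrableS (dk_int dk d) => //; apply: subset_itvr; rewrite bnd_simp.
Qed.

Lemma integrable_kpatch d : leb.-integrable setT (EFin \o (k \_ `[0, d])).
Proof. exact: (integrable_patch k (measurable_itv _)).1 (dk_int dk d). Qed.

Lemma kpatch_ge0 (D : set R) x : 0 <= (k \_ D) x.
Proof. by rewrite patchE; case: ifP => // _; exact: dk_ge0. Qed.

Lemma integrable_kshift (a b x : R) :
  leb.-integrable `[a, b] (EFin \o (fun s => k (s - x))).
Proof.
have i := integrable_shift (- x) (integrable_kpatch (b - x)).
have {}i : leb.-integrable `[a, b] (EFin \o (fun s => (k \_ `[0, b - x]) (s - x))).
  exact: integrableS i.
apply: eq_integrable i => // s; rewrite inE/= in_itv/= => /andP[_ sb].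
rewrite patchE mem_setE in_itv/= lerD2r sb andbT.
by case: leP => // /ltW /(dk_le0 dk) ->.
Qed.

(** Unnormalised: the average proper is [kavg a b x / (b - a)]. *)
Definition kavg (a b x : R) : R := \int[leb]_(s in `[a, b]) k (s - x).

Lemma kavg_ge0 a b x : 0 <= kavg a b x.
Proof. by apply: Rintegral_ge0 => s _; exact: dk_ge0. Qed.

Lemma measurable_kavg a b : measurable_fun setT (kavg a b).
Proof.
have -> : kavg a b = fun x => \int[leb]_s (\1_(`[a, b]%classic) s * k (s - x)).
  apply/funext => x; rewrite /kavg Rintegral_mkcond; apply: eq_Rintegral => s _.
  by rewrite patchE indicE; case: ifP => _; rewrite ?mul1r ?mul0r.
apply: (@measurable_partial_Rintegral _ (fun z => \1_(`[a, b]%classic) z.1 * k (z.1 - z.2))).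
apply: measurable_funM.
  by apply: measurableT_comp => //; exact: measurable_indic.
by apply: (measurableT_comp (dk_meas dk)); exact: measurable_funB.
Qed.

(** The part of [[a, b]] below x contributes nothing. Points x beyond b are included: both sides are
    then 0, [kmass] of a negative number being an integral over the empty set. *)
Lemma kavg_mid a b x : a <= x -> kavg a b x = kmass (b - x).
Proof.
move=> ax; rewrite kmassE -(@Rintegral_shift _ (- x)); last first.
  by apply: measurable_patch => //; exact: dk_meas.
rewrite /kavg Rintegral_mkcond; apply: eq_Rintegral => s _.
rewrite !patchE !mem_setE !in_itv/= subr_ge0 lerD2r.
have [xs|sx] := leP x s; first by rewrite (le_trans ax xs).
rewrite (dk_le0 dk) ?subr_le0 ?(ltW sx)//=.
by case: ifP.
Qed.

Lemma kavg_le a b x : a <= b -> kavg a b x <= kmass (b - a).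
Proof.
move=> ab; have [ax|xa] := leP a x.
  by rewrite kavg_mid// le_kmass// lerD2l lerN2.
rewrite -(@kavg_mid a)// /kavg.
(* The endpoint s = a has to be removed before comparing integrands: there [k (s - a)] is [k 0],
   which is 0, while [k (s - x)] may be positive. *)
have ioc y : leb.-integrable `]a, b] (EFin \o (fun s => k (s - y))).
  by apply: integrableS (integrable_kshift a b y) => //; apply: subset_itvr; rewrite bnd_simp.
rewrite -!Rintegral_itv_obnd_cbnd//; apply: le_Rintegral => // s.
rewrite /= in_itv/= => /andP[as_ _]; apply: (dk_dec dk); first by rewrite subr_gt0.
by rewrite lerD2l lerN2 ltW.
Qed.

Lemma kavg_itv a b x : a <= b -> x < a ->
  (b - a) * k (b - x) <= kavg a b x <= (b - a) * k (a - x).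
Proof.
move=> ab xa.
have ic (c : R) : leb.-integrable `[a, b] (EFin \o cst c).
  have i : leb.-integrable `[a, b] (EFin \o (fun x => c * \1_(`[a, b]%classic) x)).
    apply: integrableZlR => //.
    exact: integrableS (@integrable_indic_itv R a b true false).
  by apply: eq_integrable i => // y yab; rewrite /= indicE yab mulr1.
rewrite -(fine_lebesgue_itvcc ab); apply/andP; split.
  rewrite mulrC -Rintegral_cst//.
  rewrite /kavg; apply: (@le_Rintegral _ _ _ leb _ (cst (k (b - x))) (fun s => k (s - x))) => //.
    exact: integrable_kshift.
  move=> s; rewrite /= in_itv/= => /andP[as_ sb]; apply: (dk_dec dk).
    by rewrite subr_gt0 (lt_le_trans xa).
  by rewrite lerD2r.
rewrite mulrC -Rintegral_cst//.
rewrite /kavg; apply: (@le_Rintegral _ _ _ leb _ (fun s => k (s - x)) (cst (k (a - x)))) => //.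
  exact: integrable_kshift.
move=> s; rewrite /= in_itv/= => /andP[as_ sb]; apply: (dk_dec dk).
  by rewrite subr_gt0.
by rewrite lerD2r.
Qed.

Lemma kavgD a b c x : a <= b -> b <= c -> kavg a c x = kavg a b x + kavg b c x.
Proof.
move=> ab bc; have := @Rintegral_itvB _ (fun s => k (s - x)) (BLeft a) (BRight c) b
  (integrable_kshift a c x).
rewrite !bnd_simp => /(_ ab bc) E; rewrite /kavg.
rewrite -(@Rintegral_itv_obnd_cbnd _ b); last first.
  by apply: integrableS (integrable_kshift b c x) => //; apply: subset_itvr; rewrite bnd_simp.
by rewrite -E addrC subrK.
Qed.

(** At r = a - x > 0 and d = b - a this is the gap k(a - x) - k(b - x) that encloses the average
    over [a, b] and both endpoint values. *)
Let kdiff (d r : R) : R := if 0 < r then k r - k (r + d) else 0.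

Let kdiff_ge0 d r : 0 <= d -> 0 <= kdiff d r.
Proof.
move=> d0; rewrite /kdiff; case: ltP => // r0; rewrite subr_ge0.
by apply: (dk_dec dk) => //; rewrite lerDl.
Qed.

Let measurable_kdiff d : measurable_fun setT (kdiff d).
Proof.
apply: measurable_fun_ifT => //; first exact: measurable_fun_ltr.
apply: measurable_funB; first exact: dk_meas.
by apply: (measurableT_comp (dk_meas dk)); exact: measurable_funD.
Qed.

(** Telescoping: over []0, n]] the integral equals that of k over []0, d]] minus that over []n, n +
    d]], hence is at most [kmass d]. Monotone convergence removes n. *)
Lemma kdiff_int d : 0 < d -> (\int[leb]_r (kdiff d r)%:E <= (kmass d)%:E)%E.
Proof.
move=> d0.
have -> : (\int[leb]_r (kdiff d r)%:E =
    \int[leb]_(r in \bigcup_n `]0%R, n%:R]%classic) (kdiff d r)%:E)%E.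
  rewrite [RHS]integral_mkcond; apply: eq_integral => r _.
  rewrite patchE; case: ifPn => //; rewrite notin_setE /kdiff => nr.
  case: ltP => // r0; exfalso; apply: nr.
  have [n rn] : exists n : nat, r <= n%:R.
    exists (Num.truncn `|r|).+1; rewrite (le_trans (ler_norm r))// ltW//.
    exact: truncnS_gt.
  by exists n => //=; rewrite in_itv/= r0.
have nd : nondecreasing_seq (fun n : nat => `]0%R, n%:R]%classic : set (measurableTypeR R)).
  move=> m n mn; apply/subsetPset; apply: subset_itvl.
  by rewrite bnd_simp ler_nat.
have mK D : measurable_fun D (fun r => (kdiff d r)%:E).
  by apply/measurable_EFinP; exact: measurable_funTS.
have c : (\int[leb]_(r in `]0%R, n%:R]) (kdiff d r)%:E)%E @[n --> \oo] -->
    (\int[leb]_(r in \bigcup_n `]0%R, n%:R]%classic) (kdiff d r)%:E)%E.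
  apply: ge0_nondecreasing_set_cvg_integral => [|n|n|n r _]; [exact: nd|by []|exact: mK|].
  by rewrite lee_fin; exact: kdiff_ge0 (ltW d0).
rewrite -(cvg_lim _ c)//; apply: lime_le; first exact: cvgP c.
apply: nearW => n.
have ioc (a b : R) : 0 <= a -> leb.-integrable `]a, b] (EFin \o k).
  move=> a0; apply: integrableS (dk_int dk b) => // x /=; rewrite !in_itv/= => /andP[ax ->].
  by rewrite (le_trans a0 (ltW ax)).
have ish : leb.-integrable `]0, n%:R] (EFin \o (fun r => k (r + d))).
  have i : leb.-integrable `]0, n%:R] (EFin \o (fun r => k (r - - d))).
    apply: integrableS (integrable_kshift 0 n%:R (- d)) => //.
    by apply: subset_itvr; rewrite bnd_simp.
  by apply: eq_integrable i => // r _; rewrite /= opprK.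
have -> : (\int[leb]_(r in `]0%R, n%:R]) (kdiff d r)%:E =
   (\int[leb]_(r in `]0%R, n%:R]) (k r - k (r + d)))%:E)%E.
  rewrite fineK; last by apply: integrable_fin_num => //; apply: integrableBR => //; exact: ioc.
  apply: eq_integral => r; rewrite inE/= in_itv/= => /andP[r0 _].
  by rewrite /kdiff r0.
rewrite lee_fin RintegralB//; last exact: ioc.
have -> : \int[leb]_(r in `]0, n%:R]) k (r + d) = \int[leb]_(r in `]d, n%:R + d]) k r.
  rewrite [RHS]Rintegral_mkcond -(@Rintegral_shift _ d); last first.
    by apply: measurable_patch => //; exact: dk_meas.
  rewrite Rintegral_mkcond; apply: eq_Rintegral => r _.
  by rewrite !patchE !mem_setE !in_itv/= lerD2r ltrDr.
have n0 : (0 : R) <= n%:R by [].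
have := @Rintegral_itvB _ k (BRight 0) (BRight (n%:R + d)) d (ioc _ _ (lexx 0)).
rewrite !bnd_simp lerDr => /(_ (ltW d0) n0) <-; rewrite kmass_oc opprB addrCA gerDl subr_le0.
apply: ge0_subset_Rintegral => //; first exact: ioc.
  by move=> x _; exact: dk_ge0.
by apply: subset_itvl; rewrite bnd_simp lerDl ltW.
Qed.

(** Cut the kernel at 1: it is integrable on [[0, 1]] and at most [k 1] beyond, by monotonicity. *)
Lemma kernel_tame (t : R) :
  tame (fun x => k (t - x)) (fun x => (k \_ `[0, 1]) (t - x)) (k 1).
Proof.
split.
- exact: (measurableT_comp (dk_meas dk) (measurable_reflect_at t)).
- exact/integrable_reflect/integrable_kpatch.
- exact: dk_ge0.
- move=> x; rewrite ger0_norm ?dk_ge0// patchE mem_setE in_itv/=.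
  have [x0|x0] := leP 0 (t - x); last by rewrite (dk_le0 dk) ?(ltW x0)// addr_ge0 ?dk_ge0.
  rewrite /=; case: (leP (t - x) 1) => x1; first by rewrite lerDl dk_ge0.
  by rewrite -[point]/(0 : R) add0r; apply: (dk_dec dk) => //; exact: ltW.
Qed.

Lemma kavg_tame (a b : R) : a <= b -> tame (kavg a b) (cst 0) (kmass (b - a)).
Proof.
move=> ab; split.
- exact: measurable_kavg.
- exact: integrable0.
- exact: kmass_ge0.
- by move=> x; rewrite ger0_norm ?kavg_ge0// add0r kavg_le.
Qed.

(** The two values of t correspond to increments of either sign. [B1] bounds the difference for x <
    a, [B2] the average and [B3] the kernel value for a <= x < b, and for x >= b everything
    vanishes. Each majorant has integral at most [kmass (b - a)], and no bounded remainder is left,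
    which is the case M = 0. *)
Lemma kavg_diff_tame (a b t : R) : a < b -> t = a \/ t = b ->
  exists2 psi1 : R -> R,
    tame (fun x => kavg a b x / (b - a) - k (t - x)) psi1 0 &
    \int[leb]_x `|psi1 x| <= 3 * kmass (b - a).
Proof.
move=> ab tab; set d := b - a; have d0 : 0 < d by rewrite subr_gt0.
pose B1 x := kdiff d (a - x).
pose B2 x := (kmass d / d) * \1_(`[a, b]%classic) x.
pose B3 x := (k \_ `[0, d]) (t - x).
have iK : leb.-integrable setT (EFin \o kdiff d).
  apply/integrableP; split; first by apply/measurable_EFinP; exact: measurable_kdiff.
  under eq_integral => r _ do rewrite /= ger0_norm ?(kdiff_ge0 r (ltW d0))//.
  exact: le_lt_trans (kdiff_int d0) (ltry _).
have i1 : leb.-integrable setT (EFin \o B1) by exact: integrable_reflect.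
have i2 : leb.-integrable setT (EFin \o B2).
  by apply: integrableZlR => //; exact: integrable_indic_itv.
have i3 : leb.-integrable setT (EFin \o B3).
  exact/integrable_reflect/integrable_kpatch.
have B10 x : 0 <= B1 x by exact: kdiff_ge0 (ltW d0).
have B20 x : 0 <= B2 x by rewrite mulr_ge0// divr_ge0 ?kmass_ge0// ltW.
have B30 x : 0 <= B3 x by exact: kpatch_ge0.
exists (fun x => B1 x + B2 x + B3 x); last first.
  under eq_Rintegral => x _ do rewrite ger0_norm ?addr_ge0//.
  rewrite RintegralD//; last by apply: integrableDR.
  rewrite RintegralD//.
  have -> : \int[leb]_x B1 x = \int[leb]_x kdiff d x by exact: Rintegral_reflect.
  have -> : \int[leb]_x B3 x = kmass d.
    rewrite kmassE; apply: Rintegral_reflect.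
    by apply: measurable_patch => //; exact: dk_meas.
  have -> : \int[leb]_x B2 x = kmass d.
    rewrite /B2 RintegralZl//; last exact: integrable_indic_itv.
    have -> : \int[leb]_x (\1_(`[a, b]%classic) x : R) = d.
      rewrite -[RHS]mul1r /d -(fine_lebesgue_itvcc (ltW ab)) -Rintegral_cst//.
      rewrite [RHS]Rintegral_mkcond; apply: eq_Rintegral => x _.
      by rewrite indicE patchE; case: ifP.
    by rewrite divfK// gt_eqF.
  have : \int[leb]_x kdiff d x <= kmass d.
    rewrite -lee_fin fineK; first exact: kdiff_int.
    exact: integrable_fin_num.
  by lra.
split => //.
- apply: measurable_funB; first by apply: measurable_funM => //; exact: measurable_kavg.
  exact: (measurableT_comp (dk_meas dk) (measurable_reflect_at t)).
- by apply: integrableDR => //; exact: integrableDR.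
move=> x; rewrite addr0.
have [xa|ax] := ltP x a.
  apply: (@le_trans _ _ (B1 x)); last by rewrite -addrA lerDl addr_ge0.
  rewrite /B1 /kdiff subr_gt0 xa.
  have -> : a - x + d = b - x by rewrite /d; ring.
  have /andP[l u] := kavg_itv (ltW ab) xa.
  have l' : k (b - x) <= kavg a b x / d by rewrite ler_pdivlMr// mulrC.
  have u' : kavg a b x / d <= k (a - x) by rewrite ler_pdivrMr// mulrC.
  by rewrite ler_norml; case: tab => ->; apply/andP; split; lra.
have [bx|xb] := leP b x.
  rewrite kavg_mid// /kmass.
  have -> : k (t - x) = 0.
    by apply: (dk_le0 dk); case: tab => ->; rewrite subr_le0.
  have -> : \int[leb]_(x in `[0, b - x]) k x = 0.
    have [bx'|bx'] := ltP (b - x) 0.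
      by rewrite set_itv_ge ?Rintegral_set0// bnd_simp -ltNge.
    have -> : b - x = 0 by apply: le_anti; rewrite bx' subr_le0 bx.
    by rewrite set_itv1 Rintegral_set1.
  by rewrite mul0r subr0 normr0 !addr_ge0.
rewrite (le_trans (ler_normB _ _))// lerD//.
  rewrite ger0_norm ?divr_ge0 ?kavg_ge0 ?(ltW d0)// ler_wpDl//.
  rewrite /B2 indicE mem_setE in_itv/= ax (ltW xb) mulr1.
  by rewrite ler_wpM2r ?invr_ge0 ?(ltW d0)// kavg_le// ltW.
rewrite ger0_norm ?dk_ge0// /B3 patchE mem_setE in_itv/=.
case: tab => ->.
  by rewrite (dk_le0 dk) ?subr_le0//; case: ifP.
by rewrite subr_ge0 (ltW xb) lerD2l lerN2 ax.
Qed.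

End DecreasingKernel.

(** * Real and imaginary parts *)

Section ComplexParts.
Context {R : realType}.
Implicit Types x y : R[i].

Lemma ReM x y : complex.Re (x * y) =
  complex.Re x * complex.Re y - complex.Im x * complex.Im y.
Proof. by case: x => ? ?; case: y => ? ?. Qed.

Lemma ImM x y : complex.Im (x * y) =
  complex.Re x * complex.Im y + complex.Im x * complex.Re y.
Proof. by case: x => ? ?; case: y => ? ?. Qed.

Lemma ReD x y : complex.Re (x + y) = complex.Re x + complex.Re y.
Proof. by case: x => ? ?; case: y. Qed.

Lemma ImD x y : complex.Im (x + y) = complex.Im x + complex.Im y.
Proof. by case: x => ? ?; case: y. Qed.

Lemma ReN x : complex.Re (- x) = - complex.Re x.
Proof. by case: x. Qed.

Lemma ImN x : complex.Im (- x) = - complex.Im x.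
Proof. by case: x. Qed.

Lemma eqC x y : complex.Re x = complex.Re y -> complex.Im x = complex.Im y -> x = y.
Proof. by case: x => ? ?; case: y => ? ? /= -> ->. Qed.

Lemma sqmod_real (x : R) : sqmod (x%:C) = x ^+ 2.
Proof. by rewrite /sqmod/= expr0n addr0. Qed.

End ComplexParts.

(** * Identification of R^1 with R *)

Section OneVariable.
Context {R : realType}.
Local Notation leb := (@lebesgue_measure R).

(** Only n = 1 matters; a definition for all n lets [first_chaos] be written without transport along
    [n = 1]. *)
Definition diag (n : nat) (x : R) : Rn R n := nseq_tuple n (x : measurableTypeR R).

Lemma tnth_diag n x i : tnth (diag n x) i = x.
Proof. by rewrite tnth_nseq. Qed.

Lemma diag1 (v : Rn R 1) i : v = diag 1 (tnth v i).
Proof. by apply: eq_from_tnth => j; rewrite tnth_diag !ord1. Qed.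

Lemma set_coord1 (v : Rn R 1) i s : set_coord v i s = diag 1 s.
Proof. by apply: eq_from_tnth => j; rewrite tnth_diag tnth_mktuple !ord1. Qed.

Lemma partial1 i (f : Rn R 1 -> R) v :
  partial i f v = derive1 (f \o diag 1) (tnth v i).
Proof. by rewrite /partial; congr derive1; apply/funext => s; rewrite /= set_coord1. Qed.

Lemma partials1 s (f : Rn R 1 -> R) :
  partials s f \o diag 1 = derive1n (size s) (f \o diag 1).
Proof.
elim: s => // i s ih; apply/funext => x /=.
by rewrite partial1 ih tnth_diag.
Qed.

(** In one variable a list of coordinates carries only its length, which is the order of the
    derivative. *)
Lemma schwartzn1P (f : Rn R 1 -> R) : schwartzn f <-> schwartz (f \o diag 1).
Proof.
split=> [[d b]|[d b]].
  split=> [n x|n k].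
    have := d (nseq n ord0) ord0 (diag 1 x); rewrite tnth_diag.
    rewrite (_ : (fun x => _) = partials (nseq n ord0) f \o diag 1).
      by rewrite partials1 size_nseq.
    by apply/funext => y; rewrite /= set_coord1.
  have [M HM] := b (nseq n ord0) (fun=> k); exists M => x.
  have := HM (diag 1 x); rewrite big_ord1 tnth_diag.
  by rewrite -[partials _ _ _]/((partials _ f \o diag 1) x) partials1 size_nseq.
split=> [s i v|s k].
  rewrite (_ : (fun x => _) = partials s f \o diag 1); first by rewrite partials1.
  by apply/funext => x; rewrite /= set_coord1.
have [M HM] := b (size s) (k ord0); exists M => v.
rewrite (diag1 v ord0) big_ord1 tnth_diag.
by rewrite -[partials _ _ _]/((partials _ f \o diag 1) _) partials1.
Qed.

Lemma schwartzCn1P (f : Rn R 1 -> R[i]) : schwartzCn f <->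
  schwartz (fun x => complex.Re (f (diag 1 x))) /\
  schwartz (fun x => complex.Im (f (diag 1 x))).
Proof.
split=> -[a b]; split.
- exact: (schwartzn1P (fun v => complex.Re (f v))).1 a.
- exact: (schwartzn1P (fun v => complex.Im (f v))).1 b.
- exact: (schwartzn1P (fun v => complex.Re (f v))).2 a.
- exact: (schwartzn1P (fun v => complex.Im (f v))).2 b.
Qed.

Lemma integraln1 (f : Rn R 1 -> \bar R) : integraln f = (\int[leb]_x f (diag 1 x))%E.
Proof. by apply: eq_integral => x _ /=; congr f; exact: val_inj. Qed.

(** Integrability makes both parts finite; with an infinite part, the difference of the [fine]
    values could differ from [fine] of the difference. *)
Lemma Rintegraln1 (f : Rn R 1 -> R) :
  leb.-integrable setT (EFin \o (fun x => f (diag 1 x))) ->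
  Rintegraln f = \int[leb]_x f (diag 1 x).
Proof.
move=> i; rewrite /Rintegraln !integraln1 /Rintegral [in RHS]integralE [RHS]fineB.
- congr (fine _ - fine _)%R.
    by apply: eq_integral => x _; rewrite funeposE/= EFin_max.
  by apply: eq_integral => x _; rewrite funenegE/= EFin_max.
- exact: integrable_pos_fin_num.
- exact: integrable_neg_fin_num.
Qed.

Lemma Cintegraln1 (g : R -> R) (f : Rn R 1 -> R[i]) :
  leb.-integrable setT (EFin \o (fun x => g x * complex.Re (f (diag 1 x)))) ->
  leb.-integrable setT (EFin \o (fun x => g x * complex.Im (f (diag 1 x)))) ->
  Cintegraln (fun v => (g (nth 0 v 0))%:C * f v) =
  (\int[leb]_x (g x * complex.Re (f (diag 1 x)))) +i*
  (\int[leb]_x (g x * complex.Im (f (diag 1 x)))).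
Proof.
move=> i1 i2.
have E1 x : complex.Re ((g (nth 0 (diag 1 x) 0))%:C * f (diag 1 x)) =
    g x * complex.Re (f (diag 1 x)) by rewrite ReM/= mul0r subr0.
have E2 x : complex.Im ((g (nth 0 (diag 1 x) 0))%:C * f (diag 1 x)) =
    g x * complex.Im (f (diag 1 x)) by rewrite ImM/= mul0r addr0.
apply: eqC => /=.
  rewrite Rintegraln1.
    by apply: eq_Rintegral => x _; rewrite E1.
  by apply: eq_integrable i1 => // x _; rewrite /= E1.
rewrite Rintegraln1.
  by apply: eq_Rintegral => x _; rewrite E2.
by apply: eq_integrable i2 => // x _; rewrite /= E2.
Qed.

Lemma oscillatorn1 (f : Rn R 1 -> R[i]) x :
  oscillatorn f (diag 1 x) =
  osc (fun x => complex.Re (f (diag 1 x))) x +i*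
  osc (fun x => complex.Im (f (diag 1 x))) x.
Proof.
rewrite /oscillatorn enum_ordSl (size0nil (size_enum_ord 0))/=.
have P (g : Rn R 1 -> R) : partial ord0 (fun w => partial ord0 g w) (diag 1 x) =
    derive1n 2 (g \o diag 1) x.
  rewrite partial1 tnth_diag derive1nS derive1n1; congr (derive1 _ x).
  by apply/funext => s; rewrite /= partial1 tnth_diag.
rewrite /oscillator_at tnth_diag; apply: eqC => /=.
  by rewrite !ReD ReN ReM/= P mul0r subr0.
by rewrite !ImD ImN ImM/= P mul0r addr0.
Qed.

End OneVariable.

(** * First-chaos elements of the Kondratiev space *)

Section FirstChaos.
Context {R : realType}.
Local Notation leb := (@lebesgue_measure R).

(** The complex-linear extension of a real functional, placed in degree 1. The value 0 outside the
    Schwartz space is the normalisation prescribed by [Sm1]. *)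
Definition first_chaos (T : (R -> R) -> R) : gen_chaos R := fun n f =>
  if (n == 1%N) && `[< schwartzCn f >] then
    T (fun x => complex.Re (f (diag n x))) +i* T (fun x => complex.Im (f (diag n x)))
  else 0.

Definition schwartz_linear (T : (R -> R) -> R) : Prop :=
  forall (a b : R) phi psi, schwartz phi -> schwartz psi ->
    T (fun x => a * phi x + b * psi x) = a * T phi + b * T psi.

Lemma first_chaos_neq1 T n f : n != 1%N -> @first_chaos T n f = 0.
Proof. by rewrite /first_chaos => /negPf ->. Qed.

Lemma first_chaos1 T (f : Rn R 1 -> R[i]) : schwartzCn f ->
  first_chaos T f =
    T (fun x => complex.Re (f (diag 1 x))) +i* T (fun x => complex.Im (f (diag 1 x))).
Proof. by move=> sf; rewrite /first_chaos eqxx asboolT. Qed.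

Lemma schwartzCn1_lincomb (a b : R[i]) (f g : Rn R 1 -> R[i]) :
  schwartzCn f -> schwartzCn g -> schwartzCn (fun v => a * f v + b * g v).
Proof.
move=> /schwartzCn1P[f1 f2] /schwartzCn1P[g1 g2]; apply/schwartzCn1P; split.
  have := schwartz_lincomb 1 1 (schwartz_lincomb (complex.Re a) (- complex.Im a) f1 f2)
    (schwartz_lincomb (complex.Re b) (- complex.Im b) g1 g2).
  by congr schwartz; apply/funext => x; rewrite ReD !ReM; ring.
have := schwartz_lincomb 1 1 (schwartz_lincomb (complex.Re a) (complex.Im a) f2 f1)
  (schwartz_lincomb (complex.Re b) (complex.Im b) g2 g1).
by congr schwartz; apply/funext => x; rewrite ImD !ImM; ring.
Qed.

Lemma first_chaos_linear T (a b : R[i]) (f g : Rn R 1 -> R[i]) : schwartz_linear T ->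
  schwartzCn f -> schwartzCn g ->
  first_chaos T (fun v => a * f v + b * g v) = a * first_chaos T f + b * first_chaos T g.
Proof.
move=> lT sf sg; rewrite !first_chaos1//; last exact: schwartzCn1_lincomb.
have [f1 f2] := (schwartzCn1P f).1 sf; have [g1 g2] := (schwartzCn1P g).1 sg.
apply: eqC => /=.
  rewrite ReD !ReM/=.
  transitivity (T (fun x => 1 * (complex.Re a * complex.Re (f (diag 1 x)) +
      - complex.Im a * complex.Im (f (diag 1 x))) +
      1 * (complex.Re b * complex.Re (g (diag 1 x)) +
      - complex.Im b * complex.Im (g (diag 1 x))))).
    by congr T; apply/funext => x; rewrite ReD !ReM; ring.
  rewrite lT; [|exact: schwartz_lincomb|exact: schwartz_lincomb].
  by rewrite !lT//; ring.
rewrite ImD !ImM/=.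
transitivity (T (fun x => 1 * (complex.Re a * complex.Im (f (diag 1 x)) +
    complex.Im a * complex.Re (f (diag 1 x))) +
    1 * (complex.Re b * complex.Im (g (diag 1 x)) +
    complex.Im b * complex.Re (g (diag 1 x))))).
  by congr T; apply/funext => x; rewrite ImD !ImM; ring.
rewrite lT; [|exact: schwartz_lincomb|exact: schwartz_lincomb].
by rewrite !lT//; ring.
Qed.

Lemma integraln_ge0 n (f : Rn R n -> \bar R) : (forall v, 0 <= f v)%E ->
  (0 <= integraln f)%E.
Proof.
elim: n f => [|n ih] f f0 /=; first exact: f0.
by apply: integral_ge0 => x _; apply: ih => v; exact: f0.
Qed.

Lemma integraln0 n : integraln (fun _ : Rn R n => 0%E) = 0%E.
Proof.
elim: n => [//|n ih] /=.
by under eq_integral do rewrite ih; rewrite integral0.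
Qed.

Lemma Cintegraln0 n : Cintegraln (fun _ : Rn R n => 0) = 0.
Proof. by rewrite /Cintegraln /Rintegraln/= oppr0 maxxx integraln0 subrr. Qed.

Lemma dual_normsq_ge0 p n (T : functionaln R n) : (0 <= dual_normsq p T)%E.
Proof.
apply: le_ereal_inf_tmp => _ [G _ <-]; apply: integraln_ge0 => v.
by rewrite lee_fin addr_ge0 ?sqr_ge0.
Qed.

Lemma L2Cn0 n : L2Cn (fun _ : Rn R n => 0).
Proof.
split; [exact: measurable_cst|exact: measurable_cst|].
by rewrite /sqmod/= expr0n addr0 integraln0 ltry.
Qed.

Lemma dual_normsq0 p n (T : functionaln R n) : (forall f, T f = 0) ->
  dual_normsq p T = 0%E.
Proof.
move=> T0; apply/eqP; rewrite eq_le dual_normsq_ge0 andbT.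
apply: ereal_inf_lbound; exists (fun=> 0).
  split; first exact: L2Cn0.
  move=> f _; rewrite T0; under [in RHS]eq_fun do rewrite mul0r.
  by rewrite Cintegraln0.
by rewrite /sqmod/= expr0n addr0 integraln0.
Qed.

Lemma measurable_nth0 n : measurable_fun [set: Rn R n.+1] (fun v => nth 0 v 0 : measurableTypeR R).
Proof.
have -> : (fun v : Rn R n.+1 => nth 0 v 0) = (fun v => tnth v ord0).
  by apply/funext => v; rewrite (tnth_nth 0).
exact: measurable_tnth.
Qed.

Lemma L2Cn1 (g : R -> R) : measurable_fun setT g ->
  (\int[leb]_x ((g x) ^+ 2)%:E < +oo)%E ->
  L2Cn (fun v : Rn R 1 => (g (nth 0 v 0))%:C).
Proof.
move=> mg g2; split => /=.
- exact: (measurableT_comp mg (@measurable_nth0 0)).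
- exact: measurable_cst.
- by under eq_integral do rewrite sqmod_real.
Qed.

(** From 2 |G o| <= G^2 + o^2, where o^2 is again bounded by a multiple of 1 / (1 + x^2). *)
Lemma integrable_L2_decay (G o : R -> R) (M : R) : measurable_fun setT G ->
  measurable_fun setT o -> (\int[leb]_x ((G x) ^+ 2)%:E < +oo)%E ->
  (forall x, `|o x| <= M * (1 + x ^+ 2)^-1) ->
  leb.-integrable setT (EFin \o (fun x => G x * o x)).
Proof.
move=> mG mo G2 oM.
have i1 : leb.-integrable setT (EFin \o (fun x => G x ^+ 2)).
  apply/integrableP; split; first by apply/measurable_EFinP; exact: measurable_funX.
  by under eq_integral => x _ do rewrite /= ger0_norm ?sqr_ge0//.
have i2 := integrableZlR (M ^+ 2) measurableT (@integrable_oneDsqrV R).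
apply: (le_integrableR measurableT _ _ (integrableDR measurableT i1 i2)).
  exact: measurable_funM.
move=> x _.
have V0 : 0 < (1 + x ^+ 2)^-1 by rewrite invr_gt0 ltr_pwDl ?sqr_ge0.
have V1 : (1 + x ^+ 2)^-1 <= 1 by rewrite invf_le1 ?lerDl ?sqr_ge0// ltr_pwDl ?sqr_ge0.
have o2 : o x ^+ 2 <= M ^+ 2 * (1 + x ^+ 2)^-1.
  rewrite -(real_normK (num_real (o x))).
  apply: (@le_trans _ _ ((M * (1 + x ^+ 2)^-1) ^+ 2)).
    by rewrite lerXn2r// nnegrE ?normr_ge0// (le_trans _ (oM x)).
  rewrite exprMn ler_wpM2l ?sqr_ge0// expr2; set V := _^-1 in V0 V1 *; nra.
rewrite normrM; have := sqr_ge0 (`|G x| - `|o x|).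
rewrite sqrrB !real_normK ?num_real//.
have := normr_ge0 (G x); have := normr_ge0 (o x).
have := mulr_ge0 (normr_ge0 (G x)) (normr_ge0 (o x)); rewrite mulr2n; lra.
Qed.

Section Representable.
Variables (T : (R -> R) -> R) (G : R -> R).
Hypothesis lT : schwartz_linear T.
Hypothesis mG : measurable_fun setT G.
Hypothesis G2 : (\int[leb]_x ((G x) ^+ 2)%:E < +oo)%E.
Hypothesis TG : forall phi, schwartz phi -> T phi = \int[leb]_x (G x * osc phi x).

(** Only degree 1 contributes, with weight 1 as q = 0, and [G] is a competitor in the infimum that
    defines [dual_normsq] for p = 1. *)
Lemma chaos_normsq_first_chaos :
  (chaos_normsq 1 0 (first_chaos T) <= \int[leb]_x ((G x) ^+ 2)%:E)%E.
Proof.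
have E : chaos_normsq 1 0 (first_chaos T) = dual_normsq 1 (@first_chaos T 1).
  apply: lim_near_cst => //; near=> n.
  have n2 : (2 <= n)%N by near: n; exact: nbhs_infty_ge.
  rewrite -(subnK n2) addn2 big_nat_recl// big_nat_recl//=.
  rewrite !muln0 expr0 invr1 !mul1e big1 ?adde0.
    by rewrite dual_normsq0 ?add0e// => f; rewrite first_chaos_neq1.
  move=> i _; rewrite dual_normsq0 ?mule0// => f; exact: first_chaos_neq1.
rewrite E; apply: ereal_inf_lbound.
exists (fun v => (G (nth 0 v 0))%:C); last first.
  by rewrite integraln1; under eq_integral do rewrite sqmod_real.
split; first exact: L2Cn1.
move=> f sf; have [f1 f2] := (schwartzCn1P f).1 sf.
have ig phi : schwartz phi -> leb.-integrable setT (EFin \o (fun x => G x * osc phi x)).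
  move=> sphi; have [M _ HM] := osc_decay sphi.
  apply: (integrable_L2_decay mG _ G2 HM).
  by apply: continuous_measurable_fun; exact: continuous_osc.
rewrite first_chaos1// !TG// Cintegraln1 /=.
- by congr (_ +i* _); apply: eq_Rintegral => x _; rewrite oscillatorn1.
- by apply: eq_integrable (ig _ f1) => // x _; rewrite /= oscillatorn1.
- by apply: eq_integrable (ig _ f2) => // x _; rewrite /= oscillatorn1.
Unshelve. all: by end_near. Qed.

Lemma Sm1_first_chaos : Sm1 (first_chaos T).
Proof.
split.
- move=> n; have [->|n1] := eqVneq n 1%N => a b f g; first exact: first_chaos_linear.
  by move=> _ _; rewrite !first_chaos_neq1// !mulr0 addr0.
- move=> n; have [->|n1] := eqVneq n 1%N; last first.
    by move=> s f _; rewrite !first_chaos_neq1.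
  move=> s f _; congr first_chaos; apply/funext => v; congr f.
  by apply: eq_from_tnth => i; rewrite tnth_mktuple !ord1.
- by move=> n f nf; rewrite /first_chaos asboolF// andbF.
- by exists 1%N, 0%N; exact: le_lt_trans chaos_normsq_first_chaos G2.
Qed.

End Representable.

(** An identity on Schwartz functions yields equality of generalized chaoses, because all values
    outside are normalised to 0. *)
Lemma gc_lin_first_chaos (a b : R) (T S U : (R -> R) -> R) :
  (forall phi, schwartz phi -> U phi = a * T phi + b * S phi) ->
  gc_lin a%:C b%:C (first_chaos T) (first_chaos S) = first_chaos U.
Proof.
move=> H; apply: functional_extensionality_dep => n; apply/funext => f.
rewrite /gc_lin /first_chaos; case: eqVneq => [n1|]; last by rewrite !mulr0 addr0.
move: f; rewrite n1 => f; case: asboolP => [/schwartzCn1P[s1 s2]|]; last by rewrite !mulr0 addr0.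
apply: eqC => /=; rewrite ?ReD ?ImD ?ReM ?ImM/= H//; ring.
Qed.

End FirstChaos.

(** * Functionals with a density in L^1 + L^oo *)

Section TameFunctional.
Context {R : realType}.
Local Notation leb := (@lebesgue_measure R).

Lemma integrable_tame_decay (psi psi1 o : R -> R) (M N : R) : tame psi psi1 M ->
  measurable_fun setT o -> (forall x, `|o x| <= N * (1 + x ^+ 2)^-1) ->
  leb.-integrable setT (EFin \o (fun x => psi x * o x)).
Proof.
move=> [mpsi ipsi1 M0 Hpsi] mo oN.
have V1 (x : R) : (1 + x ^+ 2)^-1 <= 1.
  by rewrite invf_le1 ?lerDl ?sqr_ge0// ltr_pwDl ?sqr_ge0.
have N0 : 0 <= N.
  have := le_trans (normr_ge0 _) (oN 0); rewrite expr0n addr0 invr1 mulr1; exact.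
have io : leb.-integrable setT (EFin \o o) by exact: integrable_decay oN.
apply: (le_integrableR measurableT _ _ (integrableDR measurableT
  (integrableZlR N measurableT (integrable_norm ipsi1))
  (integrableZlR M measurableT (integrable_norm io)))).
  exact: measurable_funM.
move=> x _ /=; rewrite normrM.
have oN' : `|o x| <= N by rewrite (le_trans (oN x))// ler_piMr.
apply: (@le_trans _ _ ((`|psi1 x| + M) * `|o x|)).
  by rewrite ler_wpM2r// (le_trans (Hpsi x))// lerD2r ler_norm.
by rewrite mulrDl lerD2r mulrC ler_wpM2r.
Qed.

Lemma integrable_tame_schwartz (psi psi1 phi : R -> R) (M : R) : tame psi psi1 M ->
  schwartz phi -> leb.-integrable setT (EFin \o (fun x => psi x * phi x)).
Proof.
move=> tpsi sphi; have [N _ HN] := schwartz_decay 0 sphi.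
apply: (integrable_tame_decay tpsi (N := N)) => [|x].
  by apply: continuous_measurable_fun; exact: schwartz_continuous.
by have := HN x; rewrite expr0 mul1r.
Qed.

(** The Boolean [j] is coerced to the order 0 or 1 of the derivative, which falls on the test
    function; [psi] itself is never differentiated. *)
Definition tame_functional (j : bool) (c : R) (psi phi : R -> R) : R :=
  c * \int[leb]_x (psi x * derive1n j phi x).

Lemma tame_functional_linear j c psi psi1 M : tame psi psi1 M ->
  schwartz_linear (tame_functional j c psi).
Proof.
move=> tpsi a b phi phi' sphi sphi'; rewrite /tame_functional.
have i := integrable_tame_schwartz tpsi (schwartz_derive1n j sphi).
have i' := integrable_tame_schwartz tpsi (schwartz_derive1n j sphi').
rewrite derive1n_lincomb//.
transitivity (c * \int[leb]_x (a * (psi x * derive1n j phi x) + b * (psi x * derive1n j phi' x))).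
  by congr (c * _); apply: eq_Rintegral => x _; ring.
rewrite RintegralD//; [|exact: integrableZlR|exact: integrableZlR].
rewrite !RintegralZl//; ring.
Qed.

Definition green_kernel (j : bool) : R -> R -> R :=
  if j then green dum (- 1) else green um 1.

Lemma green_kernel_repr j phi y : schwartz phi ->
  \int[leb]_x (green_kernel j y x * osc phi x) = derive1n j phi y.
Proof. by case: j => sphi; [exact: green_dum_repr|exact: green_um_repr]. Qed.

Lemma measurable_green_kernel j :
  measurable_fun [set: (measurableTypeR R * measurableTypeR R)%type]
    (fun z => green_kernel j z.1 z.2).
Proof.
by case: j; apply: measurable_green; [exact: continuous_dum|exact: continuous_um].
Qed.

Lemma green_kernel_decay j : green_decay (green_kernel j).
Proof. by case: j; [exact: green_dum_decay|exact: green_um_decay]. Qed.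

Lemma integral_oneDsqrV_lty : (\int[leb]_x ((1 + x ^+ 2 : R)^-1)%:E < +oo)%E.
Proof.
have /integrableP[_] := @integrable_oneDsqrV R.
by under eq_integral => x _ do rewrite /= ger0_norm ?invr_ge0 ?addr_ge0 ?sqr_ge0//.
Qed.

(** The constant is fixed before the density, so the estimate is uniform. Membership with general M
    serves X_t and N_t; the norm bound with M = 0 serves the error of the difference quotient. *)
Lemma tame_functional_Sm1 j : exists2 C : R, 0 <= C &
  forall c psi psi1 M, tame psi psi1 M ->
    Sm1 (first_chaos (tame_functional j c psi)) /\
    (M = 0 -> (chaos_normsq 1 0 (first_chaos (tame_functional j c psi)) <=
      (C * (c * \int[leb]_x `|psi1 x|) ^+ 2)%:E)%E).
Proof.
have [C C0 HC] := green_kernel_decay j; have mH := measurable_green_kernel j.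
exists (32 * C ^+ 2); first by rewrite mulr_ge0// sqr_ge0.
move=> c psi psi1 M tpsi.
pose G x := c * kernel_op (green_kernel j) psi x.
have mG : measurable_fun setT G.
  by apply: measurable_funM => //; exact: (measurable_kernel_op mH tpsi).
have G2E : (\int[leb]_x ((G x) ^+ 2)%:E =
   (c ^+ 2)%:E * \int[leb]_x ((kernel_op (green_kernel j) psi x) ^+ 2)%:E)%E.
  rewrite -ge0_integralZl//.
  - by apply: eq_integral => x _; rewrite -EFinM exprMn.
  - apply/measurable_EFinP; apply: measurable_funX.
    exact: (measurable_kernel_op mH tpsi).
  - by move=> x _; rewrite lee_fin sqr_ge0.
  - by rewrite lee_fin sqr_ge0.
have L2 := kernel_op_L2 mH C0 HC tpsi.
have L2y : (\int[leb]_x ((kernel_op (green_kernel j) psi x) ^+ 2)%:E < +oo)%E.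
  apply: le_lt_trans L2 _; rewrite lte_add_pinfty ?ltry//.
  have M0 : 0 <= M by have [] := tpsi.
  rewrite lte_mul_pinfty ?lee_fin ?mulr_ge0 ?sqr_ge0//.
  exact: integral_oneDsqrV_lty.
have G2 : (\int[leb]_x ((G x) ^+ 2)%:E < +oo)%E.
  by rewrite G2E lte_mul_pinfty ?lee_fin ?sqr_ge0.
have TG phi : schwartz phi -> tame_functional j c psi phi = \int[leb]_x (G x * osc phi x).
  move=> sphi; rewrite /tame_functional.
  have ig := integrable_osc sphi.
  have := kernel_op_fubini mH C0 HC tpsi ig.
  under eq_Rintegral => y _ do rewrite green_kernel_repr//.
  move=> ->; rewrite -RintegralZl//.
    by apply: eq_Rintegral => x _; rewrite /G mulrA.
  have [N _ HN] := osc_decay sphi.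
  apply: (integrable_L2_decay _ _ _ HN).
  - exact: (measurable_kernel_op mH tpsi).
  - by apply: continuous_measurable_fun; exact: continuous_osc.
  - exact: L2y.
have lT := tame_functional_linear j c tpsi.
split; first exact: (Sm1_first_chaos lT mG G2 TG).
move=> M0; apply: le_trans (chaos_normsq_first_chaos mG G2 TG) _.
rewrite G2E; apply: le_trans (lee_wpmul2l _ L2) _; first by rewrite lee_fin sqr_ge0.
rewrite M0 mulr0 mul0r expr0n mulr0 mul0e adde0 -EFinM lee_fin le_eqVlt.
by apply/orP; left; apply/eqP; ring.
Qed.

End TameFunctional.

(** * Convolution with a nonincreasing kernel *)

Section KernelConvolution.
Context {R : realType}.
Local Notation leb := (@lebesgue_measure R).

(** [levy_tail] already vanishes for x <= 0, whereas the values of [kappa] there are arbitrary and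
    must be discarded. *)
Definition kpos (k : R -> R) (x : R) : R := if 0 < x then k x else 0.

Lemma conv_plus_kpos (k f : R -> R) x :
  conv_plus k f x = \int[leb]_s (kpos k (x - s) * f s).
Proof.
rewrite /conv_plus Rintegral_mkcond; apply: eq_Rintegral => s _.
rewrite patchE mem_setE in_itv/= /kpos subr_gt0.
by case: ifP => _; rewrite ?mul0r// mulrC.
Qed.

Lemma conv_minus_kavg (k : R -> R) t x : decreasing_kernel (kpos k) ->
  conv_minus k (\1_(`[0, t[%classic)) x = kavg (kpos k) 0 t x.
Proof.
move=> dk; rewrite /kavg -Rintegral_itv_bndo_bndc; last first.
  apply: integrableS (integrable_kshift dk 0 t x) => //.
  by apply: subset_itvl; rewrite bnd_simp.
rewrite /conv_minus Rintegral_mkcond [RHS]Rintegral_mkcond; apply: eq_Rintegral => s _.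
rewrite !patchE !mem_setE !in_itv/= andbT indicE mem_setE in_itv/= /kpos subr_gt0.
by case: (x < s); case: ifP => //= _; rewrite ?mul1r ?mul0r.
Qed.

Lemma decreasing_kernel_kpos (k : R -> R) :
  (forall x, 0 < x -> 0 <= k x) ->
  (forall x y, 0 < x -> x <= y -> k y <= k x) ->
  leb.-integrable `]0, 1[ (EFin \o k) ->
  decreasing_kernel (kpos k).
Proof.
move=> k0 kd ik.
have K0 x : 0 <= kpos k x by rewrite /kpos; case: ltP => //; exact: k0.
(* For r > 0 the set where [kpos k] is at least r is an interval, by monotonicity; for r <= 0 it is
   the whole line. *)
have mK : measurable_fun setT (kpos k).
  apply: (measurability (@RGenCInfty.G R)) => [|/= _ [_] [r] -> <-].
    exact: RGenCInfty.measurableE.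
  rewrite setTI.
  have [r0|r0] := leP r 0.
    rewrite (_ : _ @^-1` _ = setT)//; apply/seteqP; split => // x _ /=.
    by rewrite in_itv/= andbT (le_trans r0).
  apply: is_interval_measurable => s t/=.
  rewrite !in_itv/= !andbT /kpos.
  case: ltP => [s0 rs|_ /(lt_le_trans r0)]; last by rewrite ltxx.
  case: ltP => [t0 rt|_ /(lt_le_trans r0)]; last by rewrite ltxx.
  move=> u /andP[su ut]; rewrite in_itv/= andbT (lt_le_trans s0 su).
  by rewrite (le_trans rt)// kd// (lt_le_trans s0 su).
split => //.
- by move=> x x0; rewrite /kpos ltNge x0.
- by move=> x y x0 xy; rewrite /kpos x0 (lt_le_trans x0 xy) kd.
- move=> e.
  (* Majorant: k itself on []0, 1[] plus the constant [k 1] on the bounded interval. *)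
  have i1 : leb.-integrable `[0, e] (EFin \o (k \_ `]0, 1[)).
    exact: (integrableS _ _ _ ((integrable_patch k (measurable_itv _)).1 ik)).
  have i2 : leb.-integrable `[0, e] (EFin \o (fun x => k 1 * \1_(`[0, e]%classic) x)).
    apply: integrableZlR => //.
    exact: integrableS (@integrable_indic_itv R 0 e true false).
  apply: (le_integrableR _ _ _ (integrableDR (measurable_itv _) i1 i2)) => //.
    exact: measurable_funTS.
  move=> x /= xe; rewrite ger0_norm// indicE mem_setE xe mulr1.
  move: xe; rewrite patchE mem_setE !in_itv/= /kpos => /andP[x0 xe].
  case: ltP => /= x0'; last by rewrite add0r k0.
  case: ltP => x1; first by rewrite lerDl k0.
  by rewrite add0r kd.
Qed.

Lemma Rintegral_derive0 (Q g : R -> R) (M : R) :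
  (forall x, is_derive x (1 : R) Q (g x)) -> continuous g ->
  leb.-integrable setT (EFin \o g) ->
  (forall x, `|Q x| <= M * (1 + x ^+ 2)^-1) -> \int[leb]_x g x = 0.
Proof.
move=> dQ cg ig QM.
have i1 : leb.-integrable `]-oo, 0] (EFin \o g) by exact: integrableS ig.
have i2 : leb.-integrable `]0, +oo[ (EFin \o g) by exact: integrableS ig.
have q1 : Q (- n%:R) @[n --> \oo] --> (0 : R).
  by apply: (decay_cvg0 (s := fun n => - n%:R)) => n; [rewrite normrN normr_nat|exact: QM].
have q2 : Q n%:R @[n --> \oo] --> (0 : R).
  by apply: (decay_cvg0 (s := fun n => n%:R)) => n; [rewrite normr_nat|exact: QM].
rewrite (_ : setT = `]-oo, (0:R)]%classic `|` `]0, +oo[%classic); last first.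
  by apply/seteqP; split => // x _ /=; rewrite !in_itv/= andbT; case: leP; [left|right].
rewrite Rintegral_setU//; last 2 first.
- by apply: integrableS ig => //; exact: measurableU.
- apply/disj_setPS => x [/=]; rewrite !in_itv/= andbT => x0.
  by rewrite ltNge x0.
by rewrite (Rintegral_itvNyc_derive dQ cg i1 q1) (Rintegral_itvoy_derive dQ cg i2 q2) subrr.
Qed.

Section Kernel.
Variable k : R -> R.
Hypothesis dk : decreasing_kernel k.

Definition kconv (f : R -> R) (x : R) : R := \int[leb]_s (k (x - s) * f s).

(** This form puts the dependence on x into the smooth factor, ready for differentiation under the
    integral. *)
Lemma kconvE f x : measurable_fun setT f ->
  kconv f x = \int[leb]_r (k r * f (x - r)).
Proof.
move=> mf; rewrite /kconv -(@Rintegral_reflect _ x).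
  by apply: eq_Rintegral => r _; rewrite opprB addrC subrK.
apply: measurable_funM => //.
exact: (measurableT_comp (dk_meas dk) (measurable_reflect_at x)).
Qed.

Lemma is_derive_kconv (f : R -> R) (a : R) : schwartz f ->
  is_derive a 1 (kconv f) (kconv (derive1 f) a).
Proof.
move=> sf; have sf' := schwartz_derive1 sf.
have mf : measurable_fun setT f by apply: continuous_measurable_fun; exact: schwartz_continuous.
have mf' : measurable_fun setT (derive1 f).
  by apply: continuous_measurable_fun; exact: schwartz_continuous.
have -> : kconv f = fun x => \int[leb]_r (k r * f (x - r)).
  by apply/funext => x; rewrite kconvE.
rewrite kconvE//.
pose F (x r : R) := k r * f (x - r).
have dF x r : is_derive x (1 : R) (F ^~ r) (k r * derive1 f (x - r)).
  have d1 : is_derive x (1 : R) (fun x : R => x - r) 1.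
    have := is_deriveB (is_derive_id x (1 : R)) (is_derive_cst r x 1).
    by move/is_derive_eq; apply; rewrite subr0.
  have d2 := @is_derive1_comp _ f (fun x => x - r) x _ _ (schwartz_is_derive (x - r) sf) d1.
  have := is_deriveM (is_derive_cst (k r) x 1) d2.
  by move/is_derive_eq; apply; rewrite /GRing.scale/= mulr0 addr0 mulr1.
have d1F x r : partial1of2 F x r = k r * derive1 f (x - r).
  by rewrite partial1of2E; apply: derive_val.
have intF x : leb.-integrable setT (EFin \o F x).
  have := integrable_reflect x (integrable_tame_schwartz (kernel_tame dk x) sf).
  by apply: eq_integrable => // r _ /=; rewrite opprB addrC subrK.
have [M M0 HM] := schwartz_decay 0 sf'.
(* For |x - a| <= 1, (a - r)^2 <= 2 + 2 (x - r)^2, so 1 + (a - r)^2 <= 3 (1 + (x - r)^2): the decay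
   at x - r is dominated by three times that at a - r, uniformly in x. *)
pose G r := k r * (3 * M * (1 + (a - r) ^+ 2)^-1).
have intG : leb.-integrable setT (EFin \o G).
  have mV : measurable_fun setT (fun x : R => 3 * M * (1 + x ^+ 2)^-1).
    apply: measurable_funM => //.
    by apply: continuous_measurable_fun; exact: continuous_oneDsqrV.
  have b (x : R) : `|3 * M * (1 + x ^+ 2)^-1| <= 3 * M * (1 + x ^+ 2)^-1.
    by rewrite ger0_norm// !mulr_ge0// invr_ge0 addr_ge0 ?sqr_ge0.
  have := integrable_reflect a (integrable_tame_decay (kernel_tame dk a) mV b).
  by apply: eq_integrable => // r _ /=; rewrite /G opprB addrC subrK.
have Ia : `]a - 1, a + 1[%classic a by rewrite /= in_itv/=; apply/andP; split; lra.
have G0 r : 0 <= G r.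
  by rewrite !mulr_ge0 ?(dk_ge0 dk)// invr_ge0 addr_ge0 ?sqr_ge0.
have Gub x r : `]a - 1, a + 1[%classic x -> setT r -> `|partial1of2 F x r| <= G r.
  rewrite /= in_itv/= => /andP[x1 x2] _.
  rewrite d1F normrM (ger0_norm (dk_ge0 dk r)) ler_wpM2l ?(dk_ge0 dk)//.
  have := HM (x - r); rewrite expr0 mul1r => /le_trans; apply.
  rewrite [3 * M]mulrC -mulrA ler_wpM2l//.
  have p1 : 0 < 1 + (x - r) ^+ 2 by rewrite ltr_pwDl ?sqr_ge0.
  have p2 : 0 < 1 + (a - r) ^+ 2 by rewrite ltr_pwDl ?sqr_ge0.
  rewrite ler_pdivlMr// mulrC ler_pdivrMr//.
  have : (a - x) ^+ 2 <= 1 by have := sqr_ge0 (a - x); nra.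
  have := sqr_ge0 ((a - x) - (x - r)).
  by nra.
have derF x r : `]a - 1, a + 1[%classic x -> setT r -> derivable (F ^~ r) x 1.
  by move=> _ _; have [] := dF x r.
apply: DeriveDef.
  exact: (@derivable_under_integral _ _ _ leb F setT measurableT a (a - 1) (a + 1) Ia
    (fun x _ => intF x) derF G G0 intG Gub).
rewrite -derive1E.
have -> := @differentiation_under_integral _ _ _ leb F setT measurableT a (a - 1) (a + 1) Ia
    (fun x _ => intF x) derF G G0 intG Gub.
by apply: eq_Rintegral => r _; rewrite d1F.
Qed.

Lemma continuous_kconv f : schwartz f -> continuous (kconv f).
Proof.
move=> sf x; apply: differentiable_continuous; apply/derivable1_diffP.
by have [] := is_derive_kconv x sf.
Qed.

(** The integrable part of the kernel is paired with the supremum of f, the bounded part with its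
    L^1-norm; both bounds are free of x. *)
Lemma kconv_bounded f : schwartz f -> exists B : R, forall x, `|kconv f x| <= B.
Proof.
move=> sf; have [N N0 HN] := schwartz_decay 0 sf.
have fN s : `|f s| <= N.
  have := HN s; rewrite expr0 mul1r => /le_trans; apply; rewrite ler_piMr//.
  by rewrite invf_le1 ?lerDl ?sqr_ge0// ltr_pwDl ?sqr_ge0.
have mf : measurable_fun setT f by apply: continuous_measurable_fun; exact: schwartz_continuous.
have nf := integrable_norm (schwartz_integrable sf).
exists (N * \int[leb]_r (k \_ `[0, 1]) r + k 1 * \int[leb]_s `|f s|) => x.
have i := integrable_tame_schwartz (kernel_tame dk x) sf.
rewrite (le_trans (le_normr_Rintegral measurableT i))//.
rewrite -(@Rintegral_reflect _ x (k \_ `[0, 1])); last first.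
  by apply: measurable_patch => //; exact: dk_meas.
have [_ ik _ kx] := kernel_tame dk x.
rewrite -!RintegralZl// -RintegralD//; [|exact: integrableZlR|exact: integrableZlR].
apply: le_Rintegral => //.
- exact: (integrable_norm i).
- by apply: integrableDR => //; exact: integrableZlR.
- move=> s _; rewrite normrM.
  apply: (@le_trans _ _ (((k \_ `[0, 1]) (x - s) + k 1) * `|f s|)).
    by rewrite ler_wpM2r.
  by rewrite mulrDl lerD2r mulrC ler_wpM2r// (kpatch_ge0 dk).
Qed.

Lemma kconv_regular f (psi : R -> R) : schwartz f -> schwartz psi ->
  leb.-integrable setT (EFin \o (fun x => kconv f x * psi x)).
Proof.
move=> sf spsi; have [B HB] := kconv_bounded sf.
have ipsi := integrable_norm (schwartz_integrable spsi).
apply: (le_integrableR measurableT _ _ (integrableZlR B measurableT ipsi)).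
  apply: measurable_funM.
    by apply: continuous_measurable_fun; exact: continuous_kconv.
  by apply: continuous_measurable_fun; exact: schwartz_continuous.
by move=> x _ /=; rewrite normrM ler_wpM2r.
Qed.

(** The classical derivative is the distributional one: the derivative of [kconv f x * psi x]
    integrates to 0, since [kconv f] is bounded and psi decays. *)
Lemma distr_derivative_kconv f : schwartz f ->
  distr_derivative (kconv f) (kconv (derive1 f)).
Proof.
move=> sf; have sf' := schwartz_derive1 sf.
have reg g : schwartz g -> regular_tempered (kconv g).
  move=> sg; split; first by apply: continuous_measurable_fun; exact: continuous_kconv.
  by move=> psi; apply: kconv_regular => //; exact: schwartz_valP.
split; [exact: reg|exact: reg|] => psi.
have spsi := schwartz_valP psi; have spsi' := schwartz_derive1 spsi.
have i1 := kconv_regular sf spsi'; have i2 := kconv_regular sf' spsi.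
apply/eqP; rewrite -subr_eq0 opprK -RintegralD//; apply/eqP.
have [B HB] := kconv_bounded sf; have [N N0 HN] := schwartz_decay 0 spsi.
have B0 : 0 <= B by exact: le_trans (normr_ge0 _) (HB 0).
apply: (@Rintegral_derive0 (fun x => kconv f x * psi x) _ (B * N)).
- move=> x; have := is_deriveM (is_derive_kconv x sf) (schwartz_is_derive x spsi).
  by move/is_derive_eq; apply; rewrite /GRing.scale/=; ring.
- move=> x; apply: cvgD; apply: cvgM.
  + exact: continuous_kconv.
  + exact: schwartz_continuous.
  + exact: continuous_kconv.
  + exact: schwartz_continuous.
- exact: integrableDR.
- move=> x; rewrite normrM -mulrA; apply: ler_pM => //.
  by have := HN x; rewrite expr0 mul1r.
Qed.

End Kernel.
End KernelConvolution.

(** * The kernels nu and kappa *)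

Section LevyKernels.
Context {R : realType}.
Local Notation leb := (@lebesgue_measure R).

Lemma Lp_on2_sqr (D : set R) (f : R -> R) : Lp_on 2 D f ->
  measurable_fun D f /\ (\int[leb]_(x in D) ((f x) ^+ 2)%:E < +oo)%E.
Proof.
move=> [mf f2]; split => //; move: f2; congr (_ < _)%E.
apply: eq_integral => x _.
by rewrite (powR_mulrn 2) ?normr_ge0// real_normK ?num_real.
Qed.

(** On s > x the weight min(s, 1) of the Levy condition is at least min(x, 1) > 0. *)
Lemma levy_density_integrable (phi nubar : R -> R) (x : R) :
  complete_bernstein phi nubar -> 0 < x -> leb.-integrable `]x, +oo[ (EFin \o nubar).
Proof.
move=> [cm levy _] x0.
have m0 : measurable_fun (`]0, +oo[%classic : set R) nubar.
  apply: open_continuous_measurable_fun => // y; rewrite inE/= in_itv/= andbT => y0.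
  apply: differentiable_continuous; apply/derivable1_diffP.
  by have [] := cm 0%N y y0.
have p y : 0 < y -> 0 <= nubar y.
  by move=> y0; have [_] := cm 0%N y y0; rewrite expr0 mul1r.
have i0 : leb.-integrable `]0, +oo[ (EFin \o (fun s => Num.min s 1 * nubar s)).
  apply/integrableP; split.
    apply/measurable_EFinP; apply: measurable_funM => //.
    by apply: measurable_minr => //; exact: measurable_cst.
  apply: le_lt_trans levy; apply: ge0_le_integral => //.
  - apply: measurableT_comp => //; apply/measurable_EFinP; apply: measurable_funM => //.
    by apply: measurable_minr => //; exact: measurable_cst.
  - apply/measurable_EFinP; apply: measurable_funM => //.
    by apply: measurable_minr => //; exact: measurable_cst.
  - move=> s; rewrite /= in_itv/= andbT => s0.
    by rewrite ger0_norm// mulr_ge0 ?p// le_min ltW/=.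
have sub : `]x, +oo[ `<=` `]0, +oo[%classic.
  by move=> y /=; rewrite !in_itv/= !andbT; exact: lt_trans.
have i1 : leb.-integrable `]x, +oo[ (EFin \o (fun s => Num.min s 1 * nubar s)).
  exact: integrableS i0.
have c0 : 0 < Num.min x 1 by rewrite lt_min x0 ltr01.
apply: (le_integrableR _ _ _ (integrableZlR (Num.min x 1)^-1 (measurable_itv _) i1)) => //.
  exact: measurable_funS m0.
move=> s /=; rewrite in_itv/= andbT => xs.
have s0 := lt_trans x0 xs.
rewrite ger0_norm ?p// mulrA ler_peMl ?p// mulrC ler_pdivlMr// mul1r.
by rewrite le_min !ge_min (ltW xs) lexx/= orbT.
Qed.

Lemma levy_tail_decreasing (phi nubar : R -> R) : complete_bernstein phi nubar ->
  cond_A2 (levy_tail nubar) -> decreasing_kernel (kpos (levy_tail nubar)).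
Proof.
move=> cb [A2 _].
have p y : 0 < y -> 0 <= nubar y.
  by case: cb => cm _ _ y0; have [_] := cm 0%N y y0; rewrite expr0 mul1r.
have nu0 x : 0 < x -> 0 <= levy_tail nubar x.
  move=> x0; rewrite /levy_tail x0; apply: Rintegral_ge0 => z /=.
  by rewrite in_itv/= andbT => xz; apply/p/(lt_trans x0 xz).
apply: decreasing_kernel_kpos => //.
- move=> x y x0 xy; rewrite /levy_tail x0 (lt_le_trans x0 xy).
  apply: ge0_subset_Rintegral => //.
  + exact: levy_density_integrable cb x0.
  + by move=> z /=; rewrite in_itv/= andbT => xz; apply/p/(lt_trans x0 xz).
  + by apply: subset_itvr; rewrite bnd_simp.
- have [mnu nu2] := Lp_on2_sqr A2.
  (* Square integrability on an interval of finite length gives integrability, through |nu| <= 1 +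
     nu^2. *)
  have i2 : leb.-integrable `]0, 1[ (EFin \o (fun x => levy_tail nubar x ^+ 2)).
    apply/integrableP; split; first by apply/measurable_EFinP; exact: measurable_funX.
    by under eq_integral => x _ do rewrite /= ger0_norm ?sqr_ge0//.
  have i1 : leb.-integrable `]0, 1[ (EFin \o (\1_(`]0, 1[%classic) : R -> R)).
    exact: integrableS (@integrable_indic_itv R 0 1 false true).
  apply: (le_integrableR _ _ _ (integrableDR (measurable_itv _) i1 i2)) => //.
  move=> x /= xD; rewrite indicE mem_setE xD.
  rewrite -(real_normK (num_real (levy_tail nubar x))) -[true%:R]/(1 : R).
  have := sqr_ge0 (`|levy_tail nubar x| - 1); have := normr_ge0 (levy_tail nubar x).
  by nra.
Qed.

Lemma sonine_decreasing (phi kappa : R -> R) : sonine_associate phi kappa ->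
  decreasing_kernel (kpos kappa).
Proof. by move=> [k0 kd ki _]; apply: decreasing_kernel_kpos => //; exact: ki. Qed.

End LevyKernels.

(** * Random variables <omega, g> as elements of the first chaos *)

Section FirstChaosEmbedding.
Context {R : realType}.
Local Notation leb := (@lebesgue_measure R).

(** The chaos decomposition of <omega, g> has g in degree 1 and 0 elsewhere. The Schwartz functions
    approximating g in [L2_pairing] are themselves the required combinations, as the Wick power of
    degree 1 is the pairing. *)
Lemma L2_in_Sm1_first_chaos (P : probability (white_noise_space R) R)
    (g : R -> R) (F : white_noise_space R -> R) (T : (R -> R) -> R) :
  L2_pairing P g F -> Sm1 (first_chaos T) ->
  (forall psi, schwartz psi -> T psi = \int[leb]_x (g x * psi x)) ->
  L2_in_Sm1 P (fun w => (F w)%:C) (first_chaos T).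
Proof.
move=> [/Lp_on2_sqr[mg g2] L2F [xi [xig xiF]]] ST TE; split => //.
pose f n (v : Rn R n) : R[i] := if n == 1%N then (g (nth 0 v 0))%:C else 0.
exists f; last first.
  move=> n; have [->|n1] := eqVneq n 1%N => u su.
    have [u1 u2] := (schwartzCn1P u).1 su.
    have ig psi : schwartz psi -> leb.-integrable setT (EFin \o (fun x => g x * psi x)).
      move=> spsi; have [M _ HM] := schwartz_decay 0 spsi.
      apply: (integrable_L2_decay (M := M) mg _ g2) => [|x].
        by apply: continuous_measurable_fun; exact: schwartz_continuous.
      by have := HM x; rewrite expr0 mul1r.
    rewrite first_chaos1// !TE// -Cintegraln1//; [exact: ig u1|exact: ig u2].
  rewrite first_chaos_neq1// /f (negPf n1).
  by under [in RHS]eq_fun do rewrite mul0r; rewrite Cintegraln0.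
split => //.
pose Y n (w : white_noise_space R) : R[i] := if n == 1%N then (F w)%:C else 0.
exists Y; split.
- move=> n; rewrite /f /Y; case: eqVneq => [->|n1].
    split => //.
    + exact: L2Cn1.
    + by move=> s v; congr ((g _)%:C); rewrite -!(tnth_nth 0 _ ord0) tnth_mktuple !ord1.
    + exists (fun k => [:: (1, xi k)]); split.
        rewrite (_ : (fun k => _) = (fun k => L2normsq (fun x => xi k x - g x)))//.
        apply/funext => k.
        rewrite integraln1; apply: eq_integral => x _.
        rewrite big_seq1 /= mul1r /tensor_pow big_ord1 tnth_diag -rmorphB sqmod_real.
        by [].
      rewrite (_ : (fun k w => _) =
        (fun k (w : white_noise_space R) => ((w : tempered R) (xi k))%:C))//.
      by apply/funext => k; apply/funext => w; rewrite big_seq1 mul1r.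
  split => //.
  + exact: L2Cn0.
  + split; [exact: measurable_cst|exact: measurable_cst|].
    by rewrite /sqmod/= expr0n addr0 integral0 ltry.
  + exists (fun=> [::]); split.
      under eq_fun => k do under eq_fun => v do rewrite big_nil subr0 /sqmod/= expr0n addr0.
      by rewrite integraln0; exact: cvg_cst.
    rewrite /L2mu_cvg.
    under eq_fun => k do under eq_integral => w _ do rewrite big_nil subr0 /sqmod/= expr0n addr0.
    by rewrite integral0; exact: cvg_cst.
- apply: cvg_near_cst; near=> N.
  have N2 : (2 <= N)%N by near: N; exact: nbhs_infty_ge.
  apply: integral0_eq => w _; rewrite -(subnK N2) addn2 !big_ord_recl/= /Y/= big1//.
  by rewrite add0r addr0 subrr /sqmod/= expr0n addr0.
Unshelve. all: by end_near. Qed.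

End FirstChaosEmbedding.

(** * Common description of the two choices of kernel *)

Section Choice.
Context {R : realType}.
Local Notation leb := (@lebesgue_measure R).
Variables (phi nubar kappa : R -> R) (c : kernel_choice).
Hypothesis hphi : complete_bernstein phi nubar.
Hypothesis hkappa : sonine_associate phi kappa.
Hypothesis hA2 : cond_A2 (levy_tail nubar).

Definition kernel_of : R -> R :=
  kpos (match c with KernelNu => levy_tail nubar | KernelKappa => kappa end).

Definition order_of : bool := match c with KernelNu => true | KernelKappa => false end.

Definition const_of : R := Num.sqrt
  (match c with KernelNu => norm_const (levy_tail nubar)
   | KernelKappa => norm_const (primitive kappa) end).

Lemma kernel_of_decreasing : decreasing_kernel kernel_of.
Proof.
rewrite /kernel_of; case: c; first exact: levy_tail_decreasing hphi hA2.
exact: sonine_decreasing hkappa.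
Qed.

(** For [KernelNu] the function g is known only almost everywhere, but its pairings with test
    functions are determined: the sign in D_- cancels that of the distributional derivative. *)
Lemma M_minus_functional (t : R) (g psi : R -> R) : 0 < t ->
  M_minus c nubar kappa (\1_(`[0, t[%classic)) g -> schwartz psi ->
  \int[leb]_x (g x * psi x) =
  tame_functional order_of const_of (kavg kernel_of 0 t) psi.
Proof.
move=> t0 + spsi; have dk := kernel_of_decreasing.
have i := integrable_tame_schwartz (kavg_tame dk (ltW t0)).
rewrite /tame_functional; move: dk i; rewrite /kernel_of /order_of /const_of.
case: c => dk i /=.
- move=> [g0 [_ [_ r] D] gE].
  have := D (SchwartzFun spsi); rewrite /= => /esym.
  under eq_Rintegral => x _ do rewrite mulNr -mulN1r.
  have ig0 : leb.-integrable setT (EFin \o (fun x => g0 x * psi x)).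
    have := integrableZlR (-1) measurableT (r (SchwartzFun spsi)).
    by apply: eq_integrable => // x _ /=; rewrite mulN1r mulNr opprK.
  rewrite RintegralZl// mulN1r opprK => E.
  under eq_Rintegral => x _ do rewrite gE -mulrA.
  rewrite RintegralZl// E; congr (_ * _); apply: eq_Rintegral => x _.
  by rewrite conv_minus_kavg.
- move=> gE; rewrite -RintegralZl//; last exact: i.
  by apply: eq_Rintegral => x _; rewrite gE conv_minus_kavg// mulrA.
Qed.

(** For [KernelNu] the convolution with f' is continuous, hence is the representative that [M_plus]
    selects. *)
Lemma M_plus_kconv (f : R -> R) : schwartz f ->
  M_plus c nubar kappa f (fun x => const_of * kconv kernel_of (derive1n order_of f) x).
Proof.
move=> sf; have dk := kernel_of_decreasing; move: dk.
rewrite /kernel_of /order_of /const_of; case: c => dk /=.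
- exists (kconv (kpos (levy_tail nubar)) (derive1 f)) => //; split.
    exact/(continuous_kconv dk)/schwartz_derive1.
  rewrite (_ : conv_plus _ f = kconv (kpos (levy_tail nubar)) f).
    exact: distr_derivative_kconv.
  by apply/funext => x; exact: conv_plus_kpos.
- by move=> x; rewrite conv_plus_kpos.
Qed.

End Choice.

(** * Convergence of the difference quotients and the S-transform of the limit *)

Theorem theorem4p1 (R : realType) (phi nubar kappa : R -> R)
    (P : probability (white_noise_space R) R)
    (c : kernel_choice) (X : R -> white_noise_space R -> R)
    (hphi : complete_bernstein phi nubar)
    (hC : cond_C phi) (hK : cond_K phi)
    (hkappa : sonine_associate phi kappa)
    (hA1 : cond_A1 nubar) (hA2 : cond_A2 (levy_tail nubar))
    (hB1 : cond_B1 kappa) (hB2 : cond_B2 (primitive kappa))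
    (hP : white_noise_measure P)
    (hX : forall t : R, 0 < t -> X_phi P c nubar kappa (\1_(`[0, t[%classic)) (X t)) :
  exists2 Y : R -> gen_chaos R,
    forall t : R, 0 < t -> L2_in_Sm1 P (fun w => (X t w)%:C) (Y t) &
    forall t : R, 0 < t ->
      exists N : gen_chaos R,
        [/\ Sm1 N,
            Sm1_cvg (diff_quotient Y t) (0 : R)^' N &
            exists p' q : nat, forall xi, U_nbhd p' q xi ->
              exists2 g, M_plusC c nubar kappa xi g & S_transform N xi (g t)].
Proof.
set k := kernel_of nubar kappa c; set j := order_of c; set a := const_of nubar kappa c.
have dk : decreasing_kernel k by exact: kernel_of_decreasing hphi hkappa hA2.
have [C C0 HC] := @tame_functional_Sm1 R j.
pose Y t := first_chaos (tame_functional j a (kavg k 0 t)).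
exists Y => t t0.
  have [g Mg pg] := hX t t0.
  apply: (L2_in_Sm1_first_chaos pg); first exact: (HC a _ _ _ (kavg_tame dk (ltW t0))).1.
  by move=> psi spsi; rewrite (M_minus_functional hphi hkappa hA2 t0 Mg spsi).
pose N := first_chaos (tame_functional j a (fun x => k (t - x))).
exists N; split.
- exact: (HC a _ _ _ (kernel_tame dk t)).1.
(* Every basic neighbourhood contains a ball of the Hilbert space with p = 1, q = 0, so convergence
   in that norm suffices. *)
- move=> V [_ _ /(_ 1%N 0%N)[r r0 Vr]].
  have small : \forall h \near (0 : R), C * (a * (3 * kmass k `|h|)) ^+ 2 < r.
    have : C * (a * (3 * kmass k `|h|)) ^+ 2 @[h --> (0 : R)] --> C * (a * (3 * 0)) ^+ 2.
      apply: cvgM; first exact: cvg_cst.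
      have e : a * (3 * kmass k `|h|) @[h --> (0 : R)] --> a * (3 * 0).
        apply: cvgM; first exact: cvg_cst.
        apply: cvgM; first exact: cvg_cst.
        apply: (@cvg_comp _ _ _ (fun h : R => `|h|) (kmass k)); last exact: kmass_cvg0.
        have := @norm_continuous R R 0; rewrite /continuous_at normr0; exact.
      by rewrite !expr2; exact: cvgM.
    rewrite !mulr0 expr0n mulr0 => /cvgrPdist_lt /(_ _ r0).
    apply: filterS => h; rewrite sub0r normrN; exact: le_lt_trans (ler_norm _).
  have tpos : \forall h \near (0 : R), 0 < t + h.
    have : t + h @[h --> (0 : R)] --> t + 0.
      by apply: cvgD; [exact: cvg_cst|exact: cvg_id].
    by rewrite addr0 => /(cvgr_gt t); exact.
  rewrite /prop_near1 /dnbhs; near=> h.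
  have h0 : h != 0 by near: h; exact: nbhs_dnbhs_neq.
  have th : 0 < t + h by near: h; apply: cvg_within; exact: tpos.
  have hr : C * (a * (3 * kmass k `|h|)) ^+ 2 < r by near: h; apply: cvg_within; exact: small.
  (* Ordering t and t + h treats both signs of h together: for h < 0 the signs of the increment and
     of h^-1 cancel, and the quotient is again the average over [l, u], with t at one end. *)
  pose l := Num.min t (t + h); pose u := Num.max t (t + h).
  have [lu ul tl kE] : [/\ l < u, u - l = `|h|, t = l \/ t = u &
      forall x, h^-1 * kavg k 0 (t + h) x - h^-1 * kavg k 0 t x = kavg k l u x / (u - l)].
    rewrite /l /u; have [hp|hn] := ltP 0 h.
      rewrite min_l ?max_r ?lerDl ?(ltW hp)//; split.
      - by rewrite ltrDl.
      - by rewrite addrAC subrr add0r gtr0_norm.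
      - by left.
      - move=> x; rewrite (@kavgD _ _ dk 0 t (t + h)) ?(ltW t0) ?lerDl ?(ltW hp)//.
        by rewrite [t + h - t]addrAC subrr add0r; ring.
    have {}hn : h < 0 by rewrite lt_neqAle h0.
    have tht : t + h <= t by rewrite gerDl ltW.
    rewrite min_r ?max_l//; split.
    - by rewrite gtrDl.
    - by rewrite opprD addrA subrr add0r ltr0_norm.
    - by right.
    - move=> x; rewrite (@kavgD _ _ dk 0 (t + h) t) ?(ltW th)//.
      rewrite opprD addrA subrr add0r invrN; ring.
  have [psi1 tpsi Ipsi] := kavg_diff_tame dk lu tl.
  have E : gc_lin 1 (-1) (diff_quotient Y t h) N =
      first_chaos (tame_functional j a (fun x => kavg k l u x / (u - l) - k (t - x))).
    rewrite /diff_quotient.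
    have -> : - (h^-1)%:C = (- h^-1)%:C :> R[i] by rewrite rmorphN.
    rewrite (@gc_lin_first_chaos _ _ _ _ _
      (fun psi => h^-1 * tame_functional j a (kavg k 0 (t + h)) psi
                  + - h^-1 * tame_functional j a (kavg k 0 t) psi))//.
    have -> : (1 : R[i]) = 1%:C by [].
    rewrite -rmorphN; apply: gc_lin_first_chaos => psi spsi.
    have sj := schwartz_derive1n j spsi.
    have i1 := integrable_tame_schwartz (kavg_tame dk (ltW th)) sj.
    have i2 := integrable_tame_schwartz (kavg_tame dk (ltW t0)) sj.
    have i3 := integrable_tame_schwartz (kernel_tame dk t) sj.
    rewrite /tame_functional.
    transitivity (a * \int[lebesgue_measure]_x (h^-1 * (kavg k 0 (t + h) x * derive1n j psi x)
      - h^-1 * (kavg k 0 t x * derive1n j psi x) - k (t - x) * derive1n j psi x)).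
      by congr (a * _); apply: eq_Rintegral => x _; rewrite -kE; ring.
    rewrite RintegralB//; last by apply: integrableBR => //; exact: integrableZlR.
    rewrite RintegralB//; [|exact: integrableZlR|exact: integrableZlR].
    rewrite (RintegralZl _ measurableT i1) (RintegralZl _ measurableT i2).
    by move: (\int[_]_x _) (\int[_]_x _) (\int[_]_x _) => I1 I2 I3; ring.
  have [S1 S2] := HC a _ _ _ tpsi.
  rewrite /= E; apply: Vr => //; apply: le_lt_trans (S2 erefl) _.
  rewrite lte_fin; apply: le_lt_trans hr; rewrite ler_wpM2l//.
  rewrite !exprMn ler_wpM2l ?sqr_ge0// -exprMn lerXn2r ?nnegrE//.
  + by apply: Rintegral_ge0.
  + by rewrite mulr_ge0// (kmass_ge0 dk).
  + by rewrite -ul.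
(* The series of the S-transform has a single nonzero term, in degree 1, so it converges for every
   complex Schwartz function [xi]. *)
- exists 0%N, 0%N => xi [[s1 s2] _].
  pose g x := (a * kconv k (derive1n j (fun x => complex.Re (xi x))) x) +i*
              (a * kconv k (derive1n j (fun x => complex.Im (xi x))) x).
  exists g; first by split; exact: M_plus_kconv hphi hkappa hA2 _ _.
  have N1 : N 1%N (tensor_pow xi) = g t.
    have xE x : tensor_pow xi (diag 1 x) = xi x by rewrite /tensor_pow big_ord1 tnth_diag.
    have Er : (fun x => complex.Re (tensor_pow xi (diag 1 x))) = (fun x => complex.Re (xi x)).
      by apply/funext => x; rewrite xE.
    have Ei : (fun x => complex.Im (tensor_pow xi (diag 1 x))) = (fun x => complex.Im (xi x)).
      by apply/funext => x; rewrite xE.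
    rewrite /N first_chaos1; first by rewrite Er Ei.
    by apply/schwartzCn1P; rewrite Er Ei.
  have series1 (s : nat -> R) (z : R) : s 0%N = 0 -> s 1%N = z ->
      (forall n, s n.+2 = 0) -> (series s : R^nat) @ \oo --> z.
    move=> e0 e1 e2; apply: cvg_near_cst; near=> n.
    have n2 : (2 <= n)%N by near: n; exact: nbhs_infty_ge.
    rewrite -(subnK n2) addn2 /series/= big_nat_recl// big_nat_recl//= big1; last first.
      by move=> i _; exact: e2.
    by rewrite e0 e1 add0r addr0.
  split; apply: series1 => [||n]; rewrite ?N1// /N first_chaos_neq1//.
Unshelve. all: by end_near. Qed.
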